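(* Let $x>0$ and let $z$ be complex with $\mathrm{Re}(z)>1$. As $z\to 1$, $$\Theta(z,x)=\frac{2}{(z-1)^2}+\frac{2\gamma-\log(x)}{z-1}+\gamma^2-\gamma\log(x)-\frac{\pi^2}{6}+O(|z-1|),$$ where $\gamma$ is Euler's constant.
   Context: For $x>0$ and $\mathrm{Re}(z)>1$, $\Theta(z,x)$ is the absolutely convergent double series $$\Theta(z,x):=\sum_{n=1}^{\infty}\sum_{m=1}^{\infty}\frac{1}{nm(n+mx)^{z-1}}.$$ *)

(* Defs.v *)
From Stdlib Require Import Reals.
From Coquelicot Require Import Coquelicot.
Open Scope R_scope.

Definition Cexp (w : C) : C :=
  (exp (Re w) * cos (Im w), exp (Re w) * sin (Im w)).

(* [a ^ w] with the principal (real) logarithm; meaningful for [0 < a]. *)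
Definition Rcpow (a : R) (w : C) : C := Cexp (w * RtoC (ln a))%C.

(* Coquelicot's total [Series] is real-valued; a series of complex numbers
   converges exactly when its real and imaginary parts do. *)
Definition CSeries (a : nat -> C) : C :=
  (Series (fun n => Re (a n)), Series (fun n => Im (a n))).

Lemma CSeries_unique (a : nat -> C) (l : C) :
  is_series (V := C_R_NormedModule) a l -> CSeries a = l.
Proof.
intros H.
assert (Hsum : forall n, sum_n (G := C_R_NormedModule) a n =
    (sum_n (fun k => Re (a k)) n, sum_n (fun k => Im (a k)) n)).
{ induction n as [|n IH].
  - rewrite !sum_O. now destruct (a 0%nat).
  - rewrite !sum_Sn, IH. reflexivity. }
destruct l as [l1 l2]; unfold CSeries; f_equal; apply is_series_unique;
  intros P [eps HP]; destruct (H (fun c : C => ball (M := C_UniformSpace) (l1, l2) eps c)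
    (locally_ball _ _)) as [N HN]; exists N; intros n Hn; apply HP;
  specialize (HN n Hn); rewrite Hsum in HN; apply HN.
Qed.

(* The double series is indexed from 1, Coquelicot's series from 0. *)
Definition Theta (z : C) (x : R) : C :=
  CSeries (fun n => CSeries (fun m =>
    / (RtoC (INR (S n)) * RtoC (INR (S m)) *
       Rcpow (INR (S n) + INR (S m) * x) (z - 1)))%C).

(* [sum_n u n] has the [n + 1] terms [u 0, ..., u n], so the sequence is
   [1 + 1/2 + ... + 1/(n+1) - ln (n+1)]. *)
Definition euler_gamma : R :=
  real (Lim_seq (fun n => sum_n (fun k => / INR (S k)) n - ln (INR (S n)))).

(* Main.v *)
Require Import Defs.
From Stdlib Require Import Reals Lra Lia Psatz.
From Coquelicot Require Import Coquelicot.
Open Scope R_scope.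

(** Write [s = z - 1] and let [S(N)] be the sum of [1/(nm)] over [n + m x <= N].
    For [x = 1] one has exactly [S(N) = H_N^2 - H_N^(2)], with [H_N] and [H_N^(2)] the
    harmonic numbers of orders 1 and 2; replacing the inner harmonic sum by its
    asymptotics shows that a general [x] only adds [- ln x * H_N + O(ln N / N)].
    With [zeta(2) = PI^2/6] this gives [S(N) = P(ln N) + O((1 + ln N)/N)], where
    [P(L) = L^2 + (2 gamma - ln x) L + gamma^2 - gamma ln x - PI^2/6].
    Rounding [n + m x] up to an integer changes [Theta] by [O(|s|)], and summation by
    parts turns the rounded series into [sum_N S(N) (N^-s - (N+1)^-s)].  Up to [O(|s|)]
    this is the integral over [L >= 0] of [s exp(-s L) P(L)], that is
    [P(0) + P'(0)/s + P''(0)/s^2], which is the claimed expansion.  All error terms carry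
    a factor [|s|] and not [|s|^2 / Re s], so they are uniform as [z] tends to 1
    tangentially to the line [Re z = 1]. *)

(** * Finite sums *)

(** Unlike [sum_n a n], which has n + 1 terms, this sum has n terms, so that empty sums are
    available for inductions and for telescoping. *)
Fixpoint rsum (a : nat -> R) (n : nat) : R :=
  match n with O => 0 | S k => rsum a k + a k end.

Fixpoint csum (a : nat -> C) (n : nat) : C :=
  match n with O => 0%C | S k => (csum a k + a k)%C end.

Lemma rsum_ext (a b : nat -> R) (n : nat) :
  (forall k, (k < n)%nat -> a k = b k) -> rsum a n = rsum b n.
Proof. induction n; simpl; intros H; auto. rewrite IHn, H; auto. Qed.

Lemma rsum_le (a b : nat -> R) (n : nat) :
  (forall k, (k < n)%nat -> a k <= b k) -> rsum a n <= rsum b n.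
Proof.
induction n; simpl; intros H; [lra|].
apply Rplus_le_compat; auto.
Qed.

Lemma rsum_plus (a b : nat -> R) (n : nat) :
  rsum (fun k => a k + b k) n = rsum a n + rsum b n.
Proof. induction n; simpl; [|rewrite IHn]; ring. Qed.

Lemma rsum_scal (c : R) (a : nat -> R) (n : nat) :
  rsum (fun k => c * a k) n = c * rsum a n.
Proof. induction n; simpl; [|rewrite IHn]; ring. Qed.

Lemma rsum_nonneg (a : nat -> R) (n : nat) :
  (forall k, (k < n)%nat -> 0 <= a k) -> 0 <= rsum a n.
Proof.
induction n; simpl; intros H; [lra|].
apply Rplus_le_le_0_compat; auto.
Qed.

Lemma rsum_0 (a : nat -> R) (n : nat) :
  (forall k, (k < n)%nat -> a k = 0) -> rsum a n = 0.
Proof. induction n; simpl; intros H; auto. rewrite IHn, H; auto; lra. Qed.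

Lemma rsum_abs (a b : nat -> R) (n : nat) :
  (forall k, (k < n)%nat -> Rabs (a k) <= b k) -> Rabs (rsum a n) <= rsum b n.
Proof.
induction n; simpl; intros H; [rewrite Rabs_R0; lra|].
eapply Rle_trans; [apply Rabs_triang|]. apply Rplus_le_compat; auto.
Qed.

Lemma rsum_shift (a : nat -> R) (n : nat) :
  rsum a (S n) = a 0%nat + rsum (fun k => a (S k)) n.
Proof.
induction n; [simpl; ring|].
change (rsum a (S n) + a (S n) = a 0%nat + (rsum (fun k => a (S k)) n + a (S n))).
rewrite IHn; ring.
Qed.

Lemma rsum_rev (a : nat -> R) (n : nat) :
  rsum a n = rsum (fun k => a (n - S k)%nat) n.
Proof.
induction n; [reflexivity|].
rewrite (rsum_shift (fun k => a (S n - S k)%nat)); simpl.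
rewrite Nat.sub_0_r, IHn. ring.
Qed.

Lemma rsum_split (a : nat -> R) (n p : nat) :
  rsum a (n + p) = rsum a n + rsum (fun k => a (n + k)%nat) p.
Proof.
induction p; simpl; [rewrite Nat.add_0_r; ring|].
rewrite Nat.add_succ_r; simpl; rewrite IHp; ring.
Qed.

Lemma rsum_pad (a : nat -> R) (n p : nat) :
  (n <= p)%nat -> (forall k, (n <= k)%nat -> a k = 0) -> rsum a p = rsum a n.
Proof.
intros Hnp H; induction Hnp as [|p Hp IH]; simpl; auto.
rewrite H by auto; lra.
Qed.

Lemma rsum_sum_n (a : nat -> R) (n : nat) : sum_n a n = rsum a (S n).
Proof.
induction n; [rewrite sum_O; simpl; ring|].
rewrite sum_Sn, IHn; reflexivity.
Qed.

Lemma INR_S_pos (n : nat) : 0 < INR (S n).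
Proof. apply lt_0_INR; lia. Qed.

(** * Harmonic numbers and Euler's constant *)

Definition harm (n : nat) : R := rsum (fun k => / INR (S k)) n.
Definition harm2 (n : nat) : R := rsum (fun k => / INR (S k) ^ 2) n.

Lemma harm_S (n : nat) : harm (S n) = harm n + / INR (S n).
Proof. reflexivity. Qed.

Lemma harm2_S (n : nat) : harm2 (S n) = harm2 n + / INR (S n) ^ 2.
Proof. reflexivity. Qed.

Lemma ln_le_sub1 (y : R) : 0 < y -> ln y <= y - 1.
Proof.
intros Hy. pose proof (exp_ineq1_le (ln y)) as H. rewrite exp_ln in H; lra.
Qed.

Lemma ln_diff_upper (a b : R) : 0 < a -> 0 < b -> ln b - ln a <= (b - a) / a.
Proof.
intros Ha Hb. rewrite <- ln_div by assumption.
eapply Rle_trans; [apply ln_le_sub1|right; field; lra].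
now apply Rdiv_lt_0_compat.
Qed.

Lemma ln_INR_S_bounds (n : nat) : (0 < n)%nat ->
  / INR (S n) <= ln (INR (S n)) - ln (INR n) <= / INR n.
Proof.
intros Hn. assert (0 < INR n) by now apply lt_0_INR.
rewrite S_INR. split.
- pose proof (ln_diff_upper (INR n + 1) (INR n) ltac:(lra) ltac:(lra)) as H1.
  replace ((INR n - (INR n + 1)) / (INR n + 1)) with (- / (INR n + 1)) in H1 by (field; lra).
  lra.
- pose proof (ln_diff_upper (INR n) (INR n + 1) ltac:(lra) ltac:(lra)) as H1.
  replace ((INR n + 1 - INR n) / INR n) with (/ INR n) in H1 by (field; lra).
  lra.
Qed.

Lemma is_lim_seq_inv_INR_S : is_lim_seq (fun n => / INR (S n)) 0.
Proof.
apply (is_lim_seq_incr_1 (fun n => / INR n)).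
replace (Finite 0) with (Rbar_inv p_infty) by reflexivity.
apply is_lim_seq_inv; [apply is_lim_seq_INR|discriminate].
Qed.

Lemma ln_le_harm (n : nat) : ln (INR (S n)) <= harm n.
Proof.
induction n as [|n IH]; [unfold harm; simpl; rewrite ln_1; lra|].
rewrite harm_S. pose proof (ln_INR_S_bounds (S n) ltac:(lia)); lra.
Qed.

(** [real (Lim_seq _)] is Euler's constant only once convergence is known. The sequence decreases
    because 1/(n+1) <= ln (n+1) - ln n, and [ln_le_harm] bounds it below by 0. *)
Lemma euler_gamma_lim :
  is_lim_seq (fun n => harm (S n) - ln (INR (S n))) euler_gamma.
Proof.
assert (Hex : ex_finite_lim_seq (fun n => harm (S n) - ln (INR (S n)))).
{ apply ex_finite_lim_seq_decr with 0; intros n.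
  - rewrite (harm_S (S n)).
    pose proof (ln_INR_S_bounds (S n) ltac:(lia)); lra.
  - pose proof (ln_le_harm n). rewrite harm_S.
    pose proof (Rinv_0_lt_compat _ (INR_S_pos n)). lra. }
unfold euler_gamma.
rewrite (Lim_seq_ext _ (fun n => harm (S n) - ln (INR (S n)))).
- apply Lim_seq_correct', Hex.
- intros n. now rewrite rsum_sum_n.
Qed.

(** H_n - ln n decreases to gamma, while H_n - ln n - 1/n increases to gamma. *)
Lemma harm_bounds (n : nat) : (0 < n)%nat ->
  0 <= harm n - ln (INR n) - euler_gamma <= / INR n.
Proof.
intros Hn; destruct n as [|n]; [lia|].
split.
- assert (H := is_lim_seq_decr_compare (fun n => harm (S n) - ln (INR (S n)))
    euler_gamma euler_gamma_lim).
  cut (euler_gamma <= harm (S n) - ln (INR (S n))); [lra|apply H].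
  intros k. rewrite (harm_S (S k)).
  pose proof (ln_INR_S_bounds (S k) ltac:(lia)); lra.
- assert (Hl : is_lim_seq (fun n => harm (S n) - ln (INR (S n)) - / INR (S n)) euler_gamma).
  { replace (Finite euler_gamma) with (Finite (euler_gamma - 0)) by (f_equal; ring).
    apply is_lim_seq_minus'; [apply euler_gamma_lim|apply is_lim_seq_inv_INR_S]. }
  assert (H := is_lim_seq_incr_compare _ _ Hl).
  cut (harm (S n) - ln (INR (S n)) - / INR (S n) <= euler_gamma); [lra|apply H].
  intros k. rewrite (harm_S (S k)).
  pose proof (ln_INR_S_bounds (S k) ltac:(lia)); lra.
Qed.

Lemma euler_gamma_bounds : 0 <= euler_gamma <= 1.
Proof.
pose proof (harm_bounds 1 ltac:(lia)) as H.
unfold harm in H; simpl in H. rewrite ln_1, Rinv_1 in H. lra.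
Qed.

(** * The value of zeta(2) from sums of squared cosecants *)

Definition csc2 (y : R) : R := / (sin y ^ 2).

(** With t = y/2, this is 1/sin^2 t + 1/cos^2 t = 1/(sin t cos t)^2 = 4/sin^2 (2t). *)
Lemma csc2_double (y : R) : 0 < y < PI / 2 ->
  csc2 (y / 2) + csc2 (PI / 2 - y / 2) = 4 * csc2 y.
Proof.
intros Hy. pose proof PI_RGT_0.
unfold csc2. rewrite sin_shift.
replace (sin y) with (2 * sin (y / 2) * cos (y / 2)).
2: { rewrite <- sin_2a; f_equal; field. }
assert (0 < sin (y / 2)) by (apply sin_gt_0; lra).
assert (0 < cos (y / 2)) by (apply cos_gt_0; lra).
pose proof (sin2_cos2 (y / 2)) as H2. unfold Rsqr in H2.
transitivity ((sin (y/2) * sin (y/2) + cos (y/2) * cos (y/2))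
  / (sin (y/2) ^ 2 * cos (y/2) ^ 2)); [field; lra|].
rewrite H2. field; lra.
Qed.

(** The angles are the interior points cutting [0, PI/2] into M + 1 equal parts. Replacing csc^2 y
    by y^-2 turns the sum into a multiple of [harm2 M]. *)
Definition csc2_sum (M : nat) : R :=
  rsum (fun k => csc2 (INR (S k) * PI / (2 * INR (S M)))) M.

(* The angles on the left are the halves [y / 2] of those on the right, their
   complements [PI / 2 - y / 2], and [PI / 4]. *)
Lemma csc2_sum_double (M : nat) : csc2_sum (S (2 * M)) = 4 * csc2_sum M + 2.
Proof.
unfold csc2_sum. pose proof PI_RGT_0.
assert (Hd : INR (S (S (2 * M))) = 2 * INR (S M))
  by (rewrite !S_INR, mult_INR; simpl; ring).
rewrite Hd.
replace (S (2 * M)) with (M + (1 + M))%nat by lia.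
rewrite !rsum_split. cbn [rsum].
rewrite Nat.add_0_r.
replace (csc2 (INR (S M) * PI / (2 * (2 * INR (S M))))) with 2.
2: { unfold csc2. replace (INR (S M) * PI / (2 * (2 * INR (S M)))) with (PI / 4).
     - rewrite sin_PI4. pose proof Rlt_sqrt2_0. pose proof (sqrt_def 2 ltac:(lra)).
       replace ((1 / sqrt 2) ^ 2) with (/ (sqrt 2 * sqrt 2)) by (field; apply sqrt2_neq_0).
       rewrite H1; field.
     - pose proof (INR_S_pos M). field. lra. }
rewrite (rsum_rev (fun k => csc2 (INR (S (M + (1 + k))) * PI / (2 * (2 * INR (S M)))))).
rewrite <- rsum_scal.
match goal with |- ?a + (_ + ?b) = ?c + _ => enough (a + b = c) by lra end.
rewrite <- rsum_plus. apply rsum_ext; intros k Hk.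
pose proof (INR_S_pos M) as HM. pose proof (INR_S_pos k) as Hk0.
assert (HkM : INR (S k) < INR (S M)) by (apply lt_INR; lia).
rewrite <- csc2_double.
- replace (S (M + (1 + (M - S k)))) with (2 * S M - S k)%nat by lia.
  rewrite minus_INR, mult_INR by lia. change (INR 2) with 2.
  f_equal; f_equal; field; lra.
- split.
  + apply Rdiv_lt_0_compat; nra.
  + apply Rmult_lt_reg_r with (2 * INR (S M)); [lra|].
    unfold Rdiv. rewrite Rmult_assoc, Rinv_l by lra. nra.
Qed.

(** From sin y < y < tan y, since csc^2 - 1 is cot^2. *)
Lemma csc2_bounds (y : R) : 0 < y < PI / 2 -> csc2 y - 1 <= / y ^ 2 <= csc2 y.
Proof.
intros Hy. pose proof PI_RGT_0.
assert (Hs : 0 < sin y) by (apply sin_gt_0; lra).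
assert (Hc : 0 < cos y) by (apply cos_gt_0; lra).
assert (H1 : sin y < y) by (apply sin_lt_x; lra).
assert (H2 : y * cos y < sin y).
{ destruct (MVT_cor2 (fun u => sin u - u * cos u) (fun u => u * sin u) 0 y) as [c [E Hc']]; [lra| |].
  - intros c _. apply is_derive_Reals. auto_derive; auto; ring.
  - rewrite sin_0, Rmult_0_l in E.
    assert (0 < sin c) by (apply sin_gt_0; lra).
    assert (0 < c * sin c * (y - 0)) by (apply Rmult_lt_0_compat; [nra|lra]). lra. }
pose proof (sin2_cos2 y) as H3. unfold Rsqr in H3.
unfold csc2. split.
- replace (/ sin y ^ 2 - 1) with ((1 - sin y * sin y) / sin y ^ 2) by (field; lra).
  replace (1 - sin y * sin y) with (cos y ^ 2) by lra.
  apply Rmult_le_reg_r with (sin y ^ 2 * y ^ 2); [apply Rmult_lt_0_compat; nra|].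
  replace (cos y ^ 2 / sin y ^ 2 * (sin y ^ 2 * y ^ 2)) with ((y * cos y) ^ 2) by (field; lra).
  replace (/ y ^ 2 * (sin y ^ 2 * y ^ 2)) with (sin y ^ 2) by (field; lra).
  apply pow_incr; split; nra.
- apply Rinv_le_contravar; [nra|]. apply pow_incr; lra.
Qed.

(** Iterating the doubling formula from the empty sum reaches exactly the sizes 2^n - 1. This
    subsequence suffices, because [harm2_tail] controls the terms in between. *)
Lemma csc2_sum_pow2 (n : nat) : 3 * csc2_sum (2 ^ n - 1) = 2 * 4 ^ n - 2.
Proof.
induction n as [|n IH]; [unfold csc2_sum; simpl; ring|].
replace (2 ^ S n - 1)%nat with (S (2 * (2 ^ n - 1))).
- rewrite csc2_sum_double. simpl (4 ^ S n). lra.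
- assert (0 < 2 ^ n)%nat by (apply Nat.neq_0_lt_0, Nat.pow_nonzero; lia). simpl; lia.
Qed.

Lemma harm2_csc2_bounds (M : nat) :
  csc2_sum M - INR M <= harm2 M * ((2 * INR (S M)) ^ 2 / PI ^ 2) <= csc2_sum M.
Proof.
pose proof PI_RGT_0. unfold csc2_sum, harm2.
rewrite (Rmult_comm (rsum _ _)), <- rsum_scal.
assert (E : INR M = rsum (fun _ => 1) M).
{ clear; induction M; simpl rsum; [reflexivity|rewrite S_INR, IHM; ring]. }
rewrite E.
assert (Hb : forall k, (k < M)%nat ->
  csc2 (INR (S k) * PI / (2 * INR (S M))) - 1
  <= (2 * INR (S M)) ^ 2 / PI ^ 2 * / INR (S k) ^ 2
  <= csc2 (INR (S k) * PI / (2 * INR (S M)))).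
{ intros k Hk. pose proof (INR_S_pos M) as HM. pose proof (INR_S_pos k) as Hk0.
  assert (HkM : INR (S k) < INR (S M)) by (apply lt_INR; lia).
  replace ((2 * INR (S M)) ^ 2 / PI ^ 2 * / INR (S k) ^ 2)
    with (/ (INR (S k) * PI / (2 * INR (S M))) ^ 2) by (field; lra).
  apply csc2_bounds. split.
  + apply Rdiv_lt_0_compat; nra.
  + apply Rmult_lt_reg_r with (2 * INR (S M)); [lra|].
    unfold Rdiv. rewrite Rmult_assoc, Rinv_l by lra. nra. }
split.
- cut (rsum (fun k => csc2 (INR (S k) * PI / (2 * INR (S M)))) M
    <= rsum (fun k => (2 * INR (S M)) ^ 2 / PI ^ 2 * / INR (S k) ^ 2) M + rsum (fun _ => 1) M); [lra|].
  rewrite <- rsum_plus. apply rsum_le; intros k Hk. specialize (Hb k Hk). lra.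
- apply rsum_le; intros k Hk. now apply Hb.
Qed.

Lemma harm2_tail (n p : nat) : (0 < n)%nat ->
  0 <= harm2 (n + p) - harm2 n <= / INR n - / INR (n + p).
Proof.
intros Hn. induction p as [|p IH]; [rewrite Nat.add_0_r; lra|].
rewrite Nat.add_succ_r.
rewrite harm2_S.
assert (0 < INR (n + p)) by (apply lt_0_INR; lia).
rewrite S_INR. set (u := INR (n + p)) in *.
assert (0 < / (u + 1) ^ 2) by (apply Rinv_0_lt_compat; nra).
assert (/ (u + 1) ^ 2 <= / u - / (u + 1)).
{ replace (/ u - / (u + 1)) with (/ (u * (u + 1))) by (field; lra).
  apply Rinv_le_contravar; nra. }
lra.
Qed.

(** With q = 2^n the cosecant sum is (2 q^2 - 2)/3, known up to an error below q by
    [harm2_csc2_bounds]; multiplying by PI^2/(4 q^2) leaves PI^2/6 up to O(1/q). *)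
Lemma basel_pow2 : is_lim_seq (fun n => harm2 (2 ^ n - 1)) (PI ^ 2 / 6).
Proof.
pose proof PI_RGT_0.
assert (Hq : is_lim_seq (fun n => (1 / 2) ^ n) 0).
{ apply is_lim_seq_geom. rewrite Rabs_pos_eq; lra. }
assert (HM : forall n, INR (S (2 ^ n - 1)) = 2 ^ n).
{ intros n. assert (0 < 2 ^ n)%nat by (apply Nat.neq_0_lt_0, Nat.pow_nonzero; lia).
  replace (S (2 ^ n - 1)) with (2 ^ n)%nat by lia. rewrite pow_INR. reflexivity. }
assert (H4 : forall n, 4 ^ n = 2 ^ n * 2 ^ n).
{ intros n. rewrite <- Rpow_mult_distr. f_equal; ring. }
assert (Hh : forall n, (1 / 2) ^ n = / 2 ^ n).
{ intros n. rewrite <- pow_inv. f_equal. field. }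
apply (is_lim_seq_le_le
  (fun n => PI ^ 2 / 6 - PI ^ 2 / 6 * (1 / 2) ^ n * (1 / 2) ^ n - PI ^ 2 / 4 * (1 / 2) ^ n)
  _ (fun _ => PI ^ 2 / 6)).
- intros n. pose proof (harm2_csc2_bounds (2 ^ n - 1)) as Hb.
  pose proof (csc2_sum_pow2 n) as Hc.
  rewrite HM in Hb.
  assert (HMn : INR (2 ^ n - 1) = 2 ^ n - 1) by (rewrite <- (HM n), S_INR; ring).
  rewrite HMn in Hb.
  rewrite H4 in Hc. rewrite Hh. set (q := 2 ^ n) in *.
  assert (0 < q) by (apply pow_lt; lra).
  set (h := harm2 (2 ^ n - 1)) in *. set (c := csc2_sum (2 ^ n - 1)) in *.
  replace h with (h * ((2 * q) ^ 2 / PI ^ 2) * (PI ^ 2 / (4 * q ^ 2))) by (field; lra).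
  assert (HP : 0 < PI ^ 2 / (4 * q ^ 2)) by (apply Rdiv_lt_0_compat; nra).
  split.
  + apply Rle_trans with ((c - q) * (PI ^ 2 / (4 * q ^ 2))).
    * replace c with ((2 * (q * q) - 2) / 3) by lra. right. field. lra.
    * apply Rmult_le_compat_r; lra.
  + apply Rle_trans with (c * (PI ^ 2 / (4 * q ^ 2))).
    * apply Rmult_le_compat_r; lra.
    * replace c with ((2 * (q * q) - 2) / 3) by lra.
      replace (PI ^ 2 / 6) with ((2 * (q * q)) / 3 * (PI ^ 2 / (4 * q ^ 2))) by (field; lra).
      apply Rmult_le_compat_r; lra.
- replace (Finite (PI ^ 2 / 6))
    with (Finite (PI ^ 2 / 6 - PI ^ 2 / 6 * 0 * 0 - PI ^ 2 / 4 * 0)) by (f_equal; ring).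
  apply is_lim_seq_minus'; [apply is_lim_seq_minus'|].
  + apply is_lim_seq_const.
  + apply is_lim_seq_mult'; [apply is_lim_seq_mult'; [apply is_lim_seq_const|]|]; apply Hq.
  + apply is_lim_seq_mult'; [apply is_lim_seq_const|apply Hq].
- apply is_lim_seq_const.
Qed.

Lemma harm2_bounds (n : nat) : (0 < n)%nat ->
  0 <= PI ^ 2 / 6 - harm2 n <= / INR n.
Proof.
intros Hn.
assert (Hev : eventually (fun k => harm2 n <= harm2 (2 ^ k - 1) <= harm2 n + / INR n)).
{ exists (S n). intros k Hk.
  assert (k < 2 ^ k)%nat by (apply Nat.pow_gt_lin_r; lia).
  replace (2 ^ k - 1)%nat with (n + (2 ^ k - 1 - n))%nat by lia.
  pose proof (harm2_tail n (2 ^ k - 1 - n) Hn).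
  assert (0 < / INR (n + (2 ^ k - 1 - n))) by (apply Rinv_0_lt_compat, lt_0_INR; lia).
  lra. }
split.
- cut (Rbar_le (harm2 n) (PI ^ 2 / 6)); [simpl; lra|].
  apply (is_lim_seq_le_loc (fun _ => harm2 n) (fun k => harm2 (2 ^ k - 1))).
  + revert Hev; apply filter_imp; intros; lra.
  + apply is_lim_seq_const.
  + apply basel_pow2.
- cut (Rbar_le (PI ^ 2 / 6) (harm2 n + / INR n)); [simpl; lra|].
  apply (is_lim_seq_le_loc (fun k => harm2 (2 ^ k - 1)) (fun _ => harm2 n + / INR n)).
  + revert Hev; apply filter_imp; intros; lra.
  + apply basel_pow2.
  + apply is_lim_seq_const.
Qed.

(** * Asymptotics of the sum of 1/(nm) over n + m x <= N *)

(* Partial fractions: [1/(ab) = (1/a + 1/b)/(a + b)] with [a + b = n + 1]. *)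
Lemma sum_inv_prod (n : nat) :
  rsum (fun k => / INR (S k) * / INR (n - k)) n = 2 * harm n / INR (S n).
Proof.
transitivity (/ INR (S n) * (rsum (fun k => / INR (S k)) n + rsum (fun k => / INR (S (n - S k))) n)).
- rewrite <- rsum_plus, <- rsum_scal. apply rsum_ext; intros k Hk.
  replace (S (n - S k)) with (n - k)%nat by lia.
  assert (0 < INR (n - k)) by (apply lt_0_INR; lia).
  pose proof (INR_S_pos k).
  replace (INR (S n)) with (INR (S k) + INR (n - k)) by (rewrite <- plus_INR; f_equal; lia).
  field; lra.
- rewrite <- (rsum_rev (fun k => / INR (S k))). fold (harm n).
  pose proof (INR_S_pos n). field; lra.
Qed.

(** The left side sums 1/(ab) over a + b <= n + 1. Passing to n + 1 adds the antidiagonal a + b = n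
    + 2, whose sum 2 H_{n+1}/(n+2) is the increment of H^2 - H^(2). *)
Lemma sum_harm_div (n : nat) :
  rsum (fun k => / INR (S k) * harm (n - k)) n = harm (S n) ^ 2 - harm2 (S n).
Proof.
induction n as [|n IH]; [unfold harm, harm2; cbn [rsum]; change (INR 1) with 1; field|].
transitivity (rsum (fun k => / INR (S k) * harm (n - k)) n
  + rsum (fun k => / INR (S k) * / INR (S n - k)) (S n)).
- cbn [rsum]. replace (S n - n)%nat with 1%nat by lia.
  replace (harm 1) with (/ INR 1) by (unfold harm; simpl; ring).
  rewrite <- Rplus_assoc, <- rsum_plus. f_equal.
  apply rsum_ext; intros k Hk. replace (S n - k)%nat with (S (n - k)) by lia.
  rewrite harm_S; ring.
- rewrite IH, sum_inv_prod, (harm2_S (S n)), (harm_S (S n)).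
  pose proof (INR_S_pos (S n)). field; lra.
Qed.

Definition ind_le (t T : R) : R := if Rle_dec t T then 1 else 0.

Lemma ind_le_1 (t T : R) : t <= T -> ind_le t T = 1.
Proof. intros; unfold ind_le; destruct (Rle_dec t T); [reflexivity|lra]. Qed.

Lemma ind_le_0 (t T : R) : T < t -> ind_le t T = 0.
Proof. intros; unfold ind_le; destruct (Rle_dec t T); [lra|reflexivity]. Qed.

(** The sum is the harmonic number of the floor of y. The induction on A locates the floor, where
    [harm_bounds] applies; ln y exceeds the logarithm of the floor by at most its inverse. *)
Lemma harm_floor_bound (A : nat) (y : R) : 0 < y < INR (S A) ->
  Rabs (rsum (fun m => / INR (S m) * ind_le (INR (S m)) y) A - (ln y + euler_gamma)) <= 2 / y.
Proof.
revert y; induction A as [|A IH]; intros y Hy.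
(* The sum is empty for y < 1; there |ln y + gamma| <= 2/y because -ln y <= 1/y - 1 and gamma <=
   1. *)
- simpl in *. pose proof euler_gamma_bounds.
  pose proof (ln_diff_upper 1 y ltac:(lra) ltac:(lra)) as H1.
  pose proof (ln_diff_upper y 1 ltac:(lra) ltac:(lra)) as H2.
  rewrite ln_1 in *.
  replace ((1 - y) / y) with (/ y - 1) in H2 by (field; lra).
  assert (1 < / y) by (rewrite <- Rinv_1; apply Rinv_lt_contravar; lra).
  apply Rabs_le. unfold Rdiv. lra.
- destruct (Rlt_dec y (INR (S A))) as [Hlt|Hge].
  + cbn [rsum]. rewrite ind_le_0 by assumption.
    rewrite Rmult_0_r, Rplus_0_r. apply IH; lra.
  + apply Rnot_lt_le in Hge.
    rewrite (rsum_ext _ (fun m => / INR (S m))).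
    2: { intros k Hk. rewrite ind_le_1; [ring|].
         apply Rle_trans with (2 := Hge), le_INR; lia. }
    fold (harm (S A)). pose proof (harm_bounds (S A) ltac:(lia)) as Hh.
    pose proof (INR_S_pos A) as HA.
    pose proof (ln_diff_upper (INR (S A)) y HA ltac:(lra)) as H1.
    assert (H2 : ln (INR (S A)) <= ln y) by (destruct Hge as [Hge|Hge]; [left; apply ln_increasing; lra|rewrite Hge; lra]).
    rewrite S_INR in Hy.
    assert (H3 : (y - INR (S A)) / INR (S A) <= / INR (S A)).
    { unfold Rdiv. rewrite <- (Rmult_1_l (/ INR (S A))) at 2.
      apply Rmult_le_compat_r; [left; apply Rinv_0_lt_compat|]; lra. }
    assert (1 <= INR (S A)) by (rewrite S_INR; pose proof (pos_INR A); lra).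
    assert (H4 : / INR (S A) <= 2 / y).
    { apply Rmult_le_reg_r with (INR (S A) * y); [nra|].
      replace (/ INR (S A) * (INR (S A) * y)) with y by (field; lra).
      replace (2 / y * (INR (S A) * y)) with (2 * INR (S A)) by (field; lra). lra. }
    apply Rabs_le; lra.
Qed.

Definition weight (n m : nat) : R := / (INR (S n) * INR (S m)).
Definition node (x : R) (n m : nat) : R := INR (S n) + INR (S m) * x.

(** The S(N) of the outline, restricted to n, m <= A. The box contains every relevant pair once N <=
    A and N <= A x; a box independent of N keeps all sums finite during summation by parts. *)
Definition box_count (x : R) (A N : nat) : R :=
  rsum (fun n => rsum (fun m => weight n m * ind_le (node x n m) (INR N)) A) A.

Definition main_poly (x L : R) : R :=
  L ^ 2 + (2 * euler_gamma - ln x) * L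
  + (euler_gamma ^ 2 - euler_gamma * ln x - PI ^ 2 / 6).

(** For fixed n the sum over m is ln ((K+1-n)/x) + gamma up to 2x/(K+1-n), that is H_{K+1-n} - ln x
    up to (2x+1)/(K+1-n). Dividing by n and summing, [sum_harm_div] gives the main term and
    [sum_inv_prod] the error. *)
Lemma box_count_convolution (x : R) (A K : nat) : 0 < x ->
  (S K <= A)%nat -> INR (S K) <= INR A * x ->
  Rabs (box_count x A (S K) - (harm (S K) ^ 2 - harm2 (S K) - ln x * harm K))
  <= (2 * x + 1) * (2 * harm K / INR (S K)).
Proof.
intros Hx HA HAx.
rewrite <- sum_harm_div, <- sum_inv_prod, <- rsum_scal.
(* Rows with n >= K + 1 are empty, because m x > 0. *)
unfold box_count. rewrite (rsum_pad _ K A); [|lia|].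
2: { intros n Hn. apply rsum_0; intros m _. rewrite ind_le_0; [ring|].
     unfold node; pose proof (INR_S_pos m).
     assert (INR (S K) <= INR (S n)) by (apply le_INR; lia). nra. }
replace (ln x * harm K) with (rsum (fun k => ln x * / INR (S k)) K)
  by apply rsum_scal.
match goal with |- Rabs (?a - (?b - ?c)) <= _ => replace (a - (b - c)) with (a + (-1 * b + c)) by ring end.
rewrite <- rsum_scal, <- !rsum_plus.
apply rsum_abs; intros k Hk.
assert (Hj : 0 < INR (K - k)) by (apply lt_0_INR; lia).
pose proof (INR_S_pos k) as Hk0.
(* In the row n = k + 1 the condition n + m x <= K + 1 reads m <= y. *)
set (y := INR (K - k) / x).
assert (Hy : 0 < y) by (now apply Rdiv_lt_0_compat).
assert (Hyx : y * x = INR (K - k)) by (unfold y; field; lra).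
assert (HSK : INR (S K) = INR (S k) + INR (K - k)) by (rewrite <- plus_INR; f_equal; lia).
replace (rsum (fun m => weight k m * ind_le (node x k m) (INR (S K))) A)
  with (/ INR (S k) * rsum (fun m => / INR (S m) * ind_le (INR (S m)) y) A).
2: { rewrite <- rsum_scal. apply rsum_ext; intros m _. unfold weight.
     rewrite Rinv_mult, Rmult_assoc. do 2 f_equal.
     unfold ind_le, node.
     destruct (Rle_dec (INR (S m)) y); destruct (Rle_dec _ (INR (S K))); try reflexivity; nra. }
pose proof (harm_floor_bound A y) as H1.
pose proof (harm_bounds (K - k) ltac:(lia)) as H2.
match goal with |- Rabs ?e <= _ =>
  replace e with (/ INR (S k) * ((rsum (fun m => / INR (S m) * ind_le (INR (S m)) y) A - (ln y + euler_gamma))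
    - (harm (K - k) - ln (INR (K - k)) - euler_gamma)))
end.
2: { unfold y at 2. rewrite ln_div by lra. ring. }
rewrite Rabs_mult, (Rabs_pos_eq (/ INR (S k))) by (left; now apply Rinv_0_lt_compat).
replace ((2 * x + 1) * (/ INR (S k) * / INR (K - k)))
  with (/ INR (S k) * (2 / y + / INR (K - k))) by (unfold y; field; lra).
apply Rmult_le_compat_l; [left; now apply Rinv_0_lt_compat|].
eapply Rle_trans; [apply Rabs_triang|]. apply Rplus_le_compat.
- apply H1. split; [assumption|]. rewrite S_INR.
  assert (INR (K - k) < INR (S K)) by lra. nra.
- rewrite Rabs_Ropp, Rabs_pos_eq; lra.
Qed.

Lemma ln_INR_nonneg (n : nat) : 0 <= ln (INR (S n)).
Proof.
rewrite <- ln_1. apply ln_le; [lra|]. rewrite S_INR. pose proof (pos_INR n); lra.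
Qed.

Lemma box_count_asymptotics (x : R) : 0 < x -> exists c : R, 0 <= c /\
  forall A K : nat, (S K <= A)%nat -> INR (S K) <= INR A * x ->
  Rabs (box_count x A (S K) - main_poly x (ln (INR (S K))))
  <= c * ((1 + ln (INR (S K))) / INR (S K)).
Proof.
intros Hx.
(* The summands account for the error of the convolution, for that of H^2 - H^(2), and for that of
   ln x * H_K. *)
exists ((2 * x + 1) * 4 + 4 + 2 * Rabs (ln x)).
pose proof (Rabs_pos (ln x)) as Hlx. split; [lra|].
intros A K HA HAx.
pose proof (box_count_convolution x A K Hx HA HAx) as H1.
pose proof (harm_bounds (S K) ltac:(lia)) as H2.
pose proof (harm2_bounds (S K) ltac:(lia)) as H3.
pose proof (harm_S K) as H4. pose proof euler_gamma_bounds as Hg.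
pose proof (INR_S_pos K) as HK. pose proof (ln_INR_nonneg K) as HL.
set (b := box_count x A (S K)) in *. set (h := harm (S K)) in *.
set (L := ln (INR (S K))) in *. set (i := / INR (S K)) in *.
assert (Hi : 0 < i <= 1).
{ split; [now apply Rinv_0_lt_compat|]. unfold i. rewrite <- Rinv_1.
  apply Rinv_le_contravar; [lra|]. rewrite S_INR; pose proof (pos_INR K); lra. }
unfold Rdiv in *. fold i in H1. fold i.
replace (harm K) with (h - i) in H1 by lra.
set (e := h - L - euler_gamma) in *.
replace h with (e + L + euler_gamma) in * by (unfold e; ring).
unfold main_poly.
replace (b - _) with ((b - ((e + L + euler_gamma) ^ 2 - harm2 (S K) - ln x * (e + L + euler_gamma - i)))
  + (e * (e + 2 * L + 2 * euler_gamma) + (PI ^ 2 / 6 - harm2 (S K)) + ln x * (i - e))) by field.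
eapply Rle_trans; [apply Rabs_triang|].
replace (((2 * x + 1) * 4 + 4 + 2 * Rabs (ln x)) * ((1 + L) * i))
  with ((2 * x + 1) * (4 * (1 + L) * i) + (4 * ((1 + L) * i) + 2 * Rabs (ln x) * ((1 + L) * i))) by ring.
assert (0 <= L * i) by nra.
apply Rplus_le_compat.
- eapply Rle_trans; [exact H1|]. apply Rmult_le_compat_l; [lra|].
  apply Rmult_le_compat_r; lra.
- eapply Rle_trans; [apply Rabs_triang|]. apply Rplus_le_compat.
  + rewrite Rabs_pos_eq; [|nra]. nra.
  + rewrite Rabs_mult, (Rabs_pos_eq (i - e)) by lra. nra.
Qed.

(** * Complex finite sums and the complex exponential *)

Lemma csum_ext (a b : nat -> C) (n : nat) :
  (forall k, (k < n)%nat -> a k = b k) -> csum a n = csum b n.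
Proof. induction n; simpl; intros H; auto. rewrite IHn, H; auto. Qed.

Lemma csum_plus (a b : nat -> C) (n : nat) :
  csum (fun k => a k + b k)%C n = (csum a n + csum b n)%C.
Proof. induction n; simpl; [|rewrite IHn]; ring. Qed.

Lemma csum_scal (c : C) (a : nat -> C) (n : nat) :
  csum (fun k => c * a k)%C n = (c * csum a n)%C.
Proof. induction n; simpl; [|rewrite IHn]; ring. Qed.

Lemma csum_minus (a b : nat -> C) (n : nat) :
  csum (fun k => a k - b k)%C n = (csum a n - csum b n)%C.
Proof. induction n; simpl; [|rewrite IHn]; ring. Qed.

Lemma csum_norm (a : nat -> C) (b : nat -> R) (n : nat) :
  (forall k, (k < n)%nat -> Cmod (a k) <= b k) -> Cmod (csum a n) <= rsum b n.
Proof.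
induction n; simpl; intros H; [rewrite Cmod_0; lra|].
eapply Rle_trans; [apply Cmod_triangle|]. apply Rplus_le_compat; auto.
Qed.

Lemma csum_swap (a : nat -> nat -> C) (n p : nat) :
  csum (fun i => csum (a i) p) n = csum (fun j => csum (fun i => a i j) n) p.
Proof.
induction n; simpl.
- induction p; simpl; [|rewrite <- IHp]; ring.
- rewrite IHn, <- csum_plus. reflexivity.
Qed.

Lemma csum_RtoC (a : nat -> R) (n : nat) :
  csum (fun k => RtoC (a k)) n = RtoC (rsum a n).
Proof. induction n; simpl; [|rewrite IHn, RtoC_plus]; reflexivity. Qed.

Lemma csum_telescope (a : nat -> C) (n : nat) :
  csum (fun k => a (S k) - a k)%C n = (a n - a 0%nat)%C.
Proof. induction n; simpl; [|rewrite IHn]; ring. Qed.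

Lemma csum_by_parts (u : nat -> C) (v : nat -> R) (n : nat) : v 0%nat = 0 ->
  csum (fun j => u j * RtoC (v (S j) - v j))%C n
  = (RtoC (v n) * u n + csum (fun j => RtoC (v (S j)) * (u j - u (S j)))%C n)%C.
Proof.
intros H0; induction n; simpl; [rewrite H0; ring|].
rewrite IHn, RtoC_minus. ring.
Qed.

Lemma Cmod_Cexp (w : C) : Cmod (Cexp w) = exp (Re w).
Proof.
unfold Cmod, Cexp; simpl.
replace (_ + _) with (exp (Re w) ^ 2 * ((sin (Im w))² + (cos (Im w))²)) by (unfold Rsqr; simpl; ring).
rewrite sin2_cos2, Rmult_1_r. apply sqrt_pow2. left; apply exp_pos.
Qed.

Lemma Cexp_neq_0 (w : C) : Cexp w <> 0%C.
Proof. apply Cmod_gt_0. rewrite Cmod_Cexp. apply exp_pos. Qed.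

Lemma Cexp_neg (w : C) : Cexp (- w) = (/ Cexp w)%C.
Proof.
pose proof (Cexp_neq_0 w) as H.
assert (E : (Cexp (- w) * Cexp w = 1)%C).
{ destruct w as [a b]. unfold Cexp, Cmult, RtoC; simpl.
  rewrite cos_neg, sin_neg, exp_Ropp. pose proof (exp_pos a).
  pose proof (sin2_cos2 b) as H1. unfold Rsqr in H1.
  f_equal; [|ring].
  transitivity (sin b * sin b + cos b * cos b); [field; lra|assumption]. }
rewrite <- (Cmult_1_r (Cexp (- w))), <- (Cinv_r (Cexp w)) at 1 by assumption.
rewrite Cmult_assoc, E. ring.
Qed.

Lemma Re_le_Cmod (z : C) : Rabs (Re z) <= Cmod z.
Proof. apply Rle_trans with (2 := Rmax_Cmod z). apply Rmax_l. Qed.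

Lemma Im_le_Cmod (z : C) : Rabs (Im z) <= Cmod z.
Proof. apply Rle_trans with (2 := Rmax_Cmod z). apply Rmax_r. Qed.

Lemma Cmod_le_Re_Im (z : C) : Cmod z <= Rabs (Re z) + Rabs (Im z).
Proof.
replace z with (RtoC (Re z) + Ci * RtoC (Im z))%C at 1.
- eapply Rle_trans; [apply Cmod_triangle|].
  rewrite Cmod_mult, !Cmod_R.
  replace (Cmod Ci) with 1; [lra|].
  symmetry; transitivity (sqrt 1); [unfold Cmod, Ci; simpl; f_equal; ring|apply sqrt_1].
- destruct z; unfold Ci, RtoC, Cmult, Cplus; simpl; f_equal; ring.
Qed.

(** * Increments of exp(-s u) q(u) and the primitive giving the main term *)

Lemma increment_bound (f df : R -> R) (a b M : R) : a <= b ->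
  (forall u, is_derive f u (df u)) -> (forall u, a <= u <= b -> Rabs (df u) <= M) ->
  Rabs (f b - f a) <= M * (b - a).
Proof.
intros Hab Hd HM. destruct Hab as [Hab| ->].
- destruct (MVT_cor2 f df a b Hab) as [c [E Hc]].
  + intros c _. apply is_derive_Reals, Hd.
  + rewrite E, Rabs_mult, (Rabs_pos_eq (b - a)) by lra.
    apply Rmult_le_compat_r; [lra|]. apply HM; lra.
- replace (f b - f b) with 0 by ring. rewrite Rabs_R0; lra.
Qed.

(** The function is the real part of exp(-s v) (f + i g) with s = a + i b. The pair (g, -f) in place
    of (f, g) yields the imaginary part. *)
Lemma is_derive_exp_rotation (a b u f' g' : R) (f g : R -> R) :
  is_derive f u f' -> is_derive g u g' ->
  is_derive (fun v => exp (- a * v) * (cos (- b * v) * f v - sin (- b * v) * g v)) u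
    (exp (- a * u) * (cos (- b * u) * (f' - (a * f u - b * g u))
                      - sin (- b * u) * (g' - (a * g u + b * f u)))).
Proof.
intros Hf Hg. auto_derive.
- repeat split; auto; eexists; eassumption.
- change (Derive (fun v => f v) u) with (Derive f u).
  change (Derive (fun v => g v) u) with (Derive g u).
  rewrite (is_derive_unique _ _ _ Hf), (is_derive_unique _ _ _ Hg). ring.
Qed.

(* The mean value theorem is applied to the real and imaginary parts of
   [u |-> exp (- s u) q u], whence the factor 2. *)
Lemma Cexp_mult_increment (s : C) (q dq : R -> C) (a b M : R) : a <= b ->
  (forall u, is_derive (fun v => Re (q v)) u (Re (dq u))) ->
  (forall u, is_derive (fun v => Im (q v)) u (Im (dq u))) ->
  (forall u, a <= u <= b -> Cmod (Cexp (- s * RtoC u) * (dq u - s * q u))%C <= M) ->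
  Cmod (Cexp (- s * RtoC b) * q b - Cexp (- s * RtoC a) * q a)%C <= 2 * M * (b - a).
Proof.
intros Hab Hr Hi HM.
eapply Rle_trans; [apply Cmod_le_Re_Im|].
replace (2 * M * (b - a)) with (M * (b - a) + M * (b - a)) by ring.
set (d := fun u => (Cexp (- s * RtoC u) * (dq u - s * q u))%C) in *.
apply Rplus_le_compat.
- apply (increment_bound (fun u => Re (Cexp (- s * RtoC u) * q u)%C) (fun u => Re (d u)));
    [assumption| |].
  + intros u. specialize (Hr u); specialize (Hi u).
    pose proof (is_derive_exp_rotation (Re s) (Im s) u _ _ _ _ Hr Hi) as H.
    unfold d. destruct s as [s1 s2]. unfold Cexp, Cmult, RtoC; simpl in H |- *.
    rewrite !Rmult_0_r, Rminus_0_r, Rplus_0_l.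
    match type of H with is_derive _ _ ?l => match goal with |- is_derive _ _ ?r =>
      replace r with l by (unfold Re, Im; ring) end end.
    revert H; apply is_derive_ext; intros t. unfold Re, Im.
    rewrite Rminus_0_r, Rplus_0_l.
    match goal with |- ?l = ?r => change (l = r :> R) end. simpl. ring.
  + intros u Hu. eapply Rle_trans; [apply Re_le_Cmod|]. apply HM; assumption.
- apply (increment_bound (fun u => Im (Cexp (- s * RtoC u) * q u)%C) (fun u => Im (d u)));
    [assumption| |].
  + intros u. specialize (Hr u); specialize (Hi u).
    assert (Hr' : is_derive (fun v => - Re (q v)) u (- Re (dq u)))
      by now apply @is_derive_opp.
    pose proof (is_derive_exp_rotation (Re s) (Im s) u _ _ _ _ Hi Hr') as H.
    unfold d. destruct s as [s1 s2]. unfold Cexp, Cmult, RtoC; simpl in H |- *.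
    rewrite !Rmult_0_r, Rminus_0_r, Rplus_0_l.
    match type of H with is_derive _ _ ?l => match goal with |- is_derive _ _ ?r =>
      replace r with l by (unfold Re, Im; ring) end end.
    revert H; apply is_derive_ext; intros t. unfold Re, Im.
    rewrite Rminus_0_r, Rplus_0_l.
    match goal with |- ?l = ?r => change (l = r :> R) end. simpl. ring.
  + intros u Hu. eapply Rle_trans; [apply Im_le_Cmod|]. apply HM; assumption.
Qed.

Lemma Cmod_Cexp_real (s : C) (u : R) : Cmod (Cexp (- s * RtoC u)) = exp (- Re s * u).
Proof. rewrite Cmod_Cexp. f_equal. destruct s; unfold Cmult, RtoC; simpl; ring. Qed.

Lemma exp_le (a b : R) : a <= b -> exp a <= exp b.
Proof. intros [H| ->]; [left; now apply exp_increasing|lra]. Qed.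

Lemma Cexp_real_le_1 (s : C) (u : R) : 0 <= Re s -> 0 <= u ->
  Cmod (Cexp (- s * RtoC u)) <= 1.
Proof.
intros Hs Hu. rewrite Cmod_Cexp_real, <- exp_0. apply exp_le; nra.
Qed.

(** The case q = 1. Using only |exp(-s u)| <= 1 avoids any division by Re s. *)
Lemma Cexp_increment (s : C) (a b : R) : 0 <= Re s -> 0 <= a <= b ->
  Cmod (Cexp (- s * RtoC b) - Cexp (- s * RtoC a))%C <= 2 * Cmod s * (b - a).
Proof.
intros Hs Hab.
replace (Cexp (- s * RtoC b) - Cexp (- s * RtoC a))%C
  with (Cexp (- s * RtoC b) * 1 - Cexp (- s * RtoC a) * 1)%C by ring.
apply (Cexp_mult_increment s (fun _ => 1%C) (fun _ => 0%C)); [lra| | |].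
- intros u. apply @is_derive_const.
- intros u. apply @is_derive_const.
- intros u Hu. replace (0 - s * 1)%C with (- s)%C by ring.
  rewrite Cmod_mult, Cmod_opp.
  pose proof (Cexp_real_le_1 s u Hs ltac:(lra)). pose proof (Cmod_ge_0 s). nra.
Qed.

(* [- exp (- s u) * main_primitive s u] is a primitive of [s exp (- s u) main_poly u];
   at [u = 0] it is minus the main term of the theorem. *)
Definition main_primitive (x : R) (s : C) (L : R) : C :=
  (RtoC (main_poly x L) + RtoC (2 * L + (2 * euler_gamma - ln x)) / s + 2 / (s * s))%C.

Lemma main_poly_increment (x a u d : R) : 0 <= a <= u -> u <= a + d -> d <= 1 ->
  Rabs (main_poly x u - main_poly x a) <= (2 * a + 1 + Rabs (2 * euler_gamma - ln x)) * d.
Proof.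
intros Ha Hu Hd. unfold main_poly. set (b := 2 * euler_gamma - ln x).
replace (_ - _) with ((a + u + b) * (u - a)) by (unfold b; ring).
rewrite Rabs_mult, (Rabs_pos_eq (u - a)) by lra.
apply Rmult_le_compat; [apply Rabs_pos|lra| |lra].
eapply Rle_trans; [apply Rabs_triang|]. rewrite (Rabs_pos_eq (a + u)); lra.
Qed.

(** With P for [main_poly x], the derivative of exp(-s u) ([main_primitive] - P(a)) is -s exp(-s u)
    (P(u) - P(a)). The last factor is itself of order b - a, whence the square. *)
Lemma main_step_bound (x : R) (s : C) (a b : R) : 0 < Re s -> 0 <= a <= b -> b - a <= 1 ->
  Cmod (RtoC (main_poly x a) * (Cexp (- s * RtoC a) - Cexp (- s * RtoC b))
    - (Cexp (- s * RtoC a) * main_primitive x s a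
       - Cexp (- s * RtoC b) * main_primitive x s b))%C
  <= 2 * Cmod s * (2 * a + 1 + Rabs (2 * euler_gamma - ln x)) * (b - a) ^ 2.
Proof.
intros Hs Hab Hd.
assert (Hs0 : s <> 0%C) by (intros ->; simpl in Hs; lra).
set (q := fun u => (main_primitive x s u - RtoC (main_poly x a))%C).
replace (_ - _)%C with (Cexp (- s * RtoC b) * q b - Cexp (- s * RtoC a) * q a)%C
  by (unfold q; ring).
replace (2 * Cmod s * _ * _) with
  (2 * (Cmod s * ((2 * a + 1 + Rabs (2 * euler_gamma - ln x)) * (b - a))) * (b - a)) by ring.
apply (Cexp_mult_increment s q
  (fun u => RtoC (2 * u + (2 * euler_gamma - ln x)) + RtoC 2 / s)%C); [lra| | |].
- intros u. unfold q, main_primitive, main_poly, Cdiv. destruct (/ s)%C as [c d].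
  destruct (2 * / (s * s))%C as [e f]. simpl. auto_derive; auto; ring.
- intros u. unfold q, main_primitive, main_poly, Cdiv. destruct (/ s)%C as [c d].
  destruct (2 * / (s * s))%C as [e f]. simpl. auto_derive; auto; ring.
- intros u Hu.
  replace (_ - s * q u)%C with (- s * RtoC (main_poly x u - main_poly x a))%C.
  2: { unfold q, main_primitive. rewrite RtoC_minus. field. assumption. }
  rewrite !Cmod_mult, Cmod_opp, Cmod_R.
  rewrite <- (Rmult_1_l (Cmod s * (_ * _))).
  apply Rmult_le_compat.
  + apply Cmod_ge_0.
  + apply Rmult_le_pos; [apply Cmod_ge_0|apply Rabs_pos].
  + apply Cexp_real_le_1; lra.
  + apply Rmult_le_compat_l; [apply Cmod_ge_0|].
    apply main_poly_increment; lra.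
Qed.

(** * Domination by the series of n^(-1-p) *)

Definition zterm (p : R) (n : nat) : R := exp (- (1 + p) * ln (INR (S n))).

Lemma zterm_pos (p : R) (n : nat) : 0 < zterm p n.
Proof. apply exp_pos. Qed.

(** Write (n+1)^-p as (n+2)^-p exp(p d) with d = ln (n+2) - ln (n+1) >= 1/(n+2), and use exp y >= 1
    + y. This makes the partial sums telescope. *)
Lemma zterm_step (p : R) (n : nat) : 0 < p ->
  p * zterm p (S n) <= exp (- p * ln (INR (S n))) - exp (- p * ln (INR (S (S n)))).
Proof.
intros Hp. pose proof (ln_INR_S_bounds (S n) ltac:(lia)) as Hr.
unfold zterm. pose proof (INR_S_pos (S n)) as H2.
set (a := ln (INR (S n))) in *. set (b := ln (INR (S (S n)))) in *.
replace (- (1 + p) * b) with (- p * b + - b) by ring.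
rewrite exp_plus, (exp_Ropp b). unfold b at 2. rewrite exp_ln by assumption.
replace (- p * a) with (- p * b + p * (b - a)) by ring.
rewrite exp_plus. pose proof (exp_ineq1_le (p * (b - a))).
pose proof (exp_pos (- p * b)).
assert (p * / INR (S (S n)) <= p * (b - a)) by (apply Rmult_le_compat_l; lra).
nra.
Qed.

Lemma zterm_sum_bound (p : R) (n : nat) : 0 < p -> rsum (zterm p) n <= 1 + / p.
Proof.
intros Hp.
cut (p * rsum (zterm p) n <= p + 1).
{ intros H. apply Rmult_le_reg_l with p; [assumption|].
  replace (p * (1 + / p)) with (p + 1) by (field; lra). assumption. }
destruct n as [|n]; [simpl; lra|].
cut (p * rsum (zterm p) (S n) <= p + 1 - exp (- p * ln (INR (S n)))).
{ pose proof (exp_pos (- p * ln (INR (S n)))). lra. }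
induction n as [|n IH].
- unfold zterm; simpl. rewrite ln_1, !Rmult_0_r, exp_0. lra.
- change (rsum (zterm p) (S (S n))) with (rsum (zterm p) (S n) + zterm p (S n)).
  pose proof (zterm_step p n Hp). lra.
Qed.

Lemma node_ge_1 (x : R) (n m : nat) : 0 < x -> 1 <= node x n m.
Proof.
intros Hx. unfold node. pose proof (INR_S_pos m). rewrite S_INR. pose proof (pos_INR n). nra.
Qed.

(* [n + m x >= max (n, m x) >= sqrt (n m x)]. *)
Lemma weight_node_bound (x p : R) (n m : nat) : 0 < x -> 0 <= p ->
  weight n m * exp (- p * ln (node x n m))
  <= exp (- p / 2 * ln x) * (zterm (p / 2) n * zterm (p / 2) m).
Proof.
intros Hx Hp. unfold weight, zterm, node.
pose proof (INR_S_pos n) as Hn. pose proof (INR_S_pos m) as Hm.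
set (a := INR (S n)) in *. set (b := INR (S m)) in *.
assert (H1 : ln a <= ln (a + b * x)) by (apply ln_le; nra).
assert (H2 : ln b + ln x <= ln (a + b * x)).
{ rewrite <- ln_mult by assumption. apply ln_le; nra. }
rewrite <- (exp_ln (a * b)) at 1 by nra.
rewrite ln_mult, <- exp_Ropp, <- !exp_plus by assumption.
apply exp_le. nra.
Qed.

Lemma rsum_prod (c : R) (g h : nat -> R) (n p : nat) :
  rsum (fun i => rsum (fun j => c * (g i * h j)) p) n = c * (rsum g n * rsum h p).
Proof.
transitivity (rsum (fun i => (c * rsum h p) * g i) n).
- apply rsum_ext; intros i _.
  rewrite (rsum_ext _ (fun j => (c * g i) * h j)) by (intros; ring).
  rewrite rsum_scal. ring.
- rewrite rsum_scal. ring.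
Qed.

Lemma weight_node_sum (x p : R) (A B : nat) : 0 < x -> 0 < p ->
  rsum (fun n => rsum (fun m => weight n m * exp (- p * ln (node x n m))) B) A
  <= exp (- p / 2 * ln x) * ((1 + 2 / p) * (1 + 2 / p)).
Proof.
intros Hx Hp.
eapply Rle_trans.
- apply rsum_le; intros n _. apply rsum_le; intros m _.
  apply weight_node_bound; lra.
- rewrite rsum_prod. apply Rmult_le_compat_l; [left; apply exp_pos|].
  replace (2 / p) with (/ (p / 2)) by (field; lra).
  apply Rmult_le_compat; try (apply zterm_sum_bound; lra);
    apply rsum_nonneg; intros; left; apply zterm_pos.
Qed.

(** * Rounding n + m x up to an integer *)

Definition cpow_neg (s : C) (t : R) : C := Cexp (- s * RtoC (ln t)).

(** Two truncations: the box makes the sum finite, and the cutoff n + m x <= K allows collecting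
    terms by the ceiling of n + m x. *)
Definition partial_theta (x : R) (s : C) (A K : nat) : C :=
  csum (fun n => csum (fun m =>
    RtoC (weight n m * ind_le (node x n m) (INR K)) * cpow_neg s (node x n m)) A)%C A.

Lemma weight_nonneg (n m : nat) : 0 <= weight n m.
Proof.
left. apply Rinv_0_lt_compat, Rmult_lt_0_compat; apply INR_S_pos.
Qed.

(* The sum equals [cpow_neg s] at the ceiling of [t] if [t <= K], and [0] otherwise. *)
Lemma ceiling_bound (s : C) (t : R) (K : nat) : 0 < Re s -> 1 <= t ->
  Cmod (RtoC (ind_le t (INR K)) * cpow_neg s t
        - csum (fun j => cpow_neg s (INR (S j))
                         * RtoC (ind_le t (INR (S j)) - ind_le t (INR j)))%C K)%C
  <= 2 * Cmod s * exp (- 1 * ln t).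
Proof.
intros Hs Ht. pose proof (Cmod_ge_0 s) as Hms.
replace (exp (- 1 * ln t)) with (/ t)
  by (replace (- 1 * ln t) with (- ln t) by ring; rewrite exp_Ropp, exp_ln; lra).
assert (Hit : 0 < / t) by (apply Rinv_0_lt_compat; lra).
assert (Hz : forall k, INR k < t -> csum (fun j => cpow_neg s (INR (S j))
   * RtoC (ind_le t (INR (S j)) - ind_le t (INR j)))%C k = 0%C).
{ induction k as [|k IH]; intros Hk; [reflexivity|].
  rewrite S_INR in Hk. cbn [csum]. rewrite IH by lra.
  rewrite !ind_le_0 by (rewrite ?S_INR; lra). rewrite Rminus_0_r. ring. }
assert (Hpos : 0 <= 2 * Cmod s * / t) by nra.
induction K as [|K IH].
- cbn [csum INR]. rewrite ind_le_0 by lra.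
  replace (RtoC 0 * cpow_neg s t - 0)%C with (RtoC 0) by ring. rewrite Cmod_0; assumption.
- cbn [csum]. destruct (Rle_dec t (INR K)) as [H1|H1].
  + rewrite (ind_le_1 t (INR (S K))) by (rewrite S_INR; lra).
    rewrite (ind_le_1 t (INR K)) in * by assumption.
    rewrite Rminus_diag, Cmult_0_r, Cplus_0_r. assumption.
  + apply Rnot_le_lt in H1. rewrite Hz, (ind_le_0 t (INR K)), Rminus_0_r by assumption.
    destruct (Rle_dec t (INR (S K))) as [H2|H2].
    * rewrite ind_le_1 by assumption.
      replace (_ - _)%C with (- (cpow_neg s (INR (S K)) - cpow_neg s t))%C by ring.
      rewrite Cmod_opp. unfold cpow_neg.
      (* Here K < t <= K + 1, so t is within 1 of its ceiling and the logarithms differ by at most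
         1/t. *)
      assert (0 <= ln t) by (rewrite <- ln_1; apply ln_le; lra).
      assert (ln t <= ln (INR (S K))) by (apply ln_le; lra).
      eapply Rle_trans; [apply Cexp_increment; lra|].
      apply Rmult_le_compat_l; [lra|].
      eapply Rle_trans; [apply ln_diff_upper; lra|].
      rewrite <- (Rmult_1_l (/ t)). apply Rmult_le_compat_r; [lra|].
      rewrite S_INR; lra.
    * rewrite ind_le_0 by lra.
      replace (_ - _)%C with (RtoC 0) by ring. rewrite Cmod_0; assumption.
Qed.

(** Rounding a node t costs 2|s|/t by [ceiling_bound]. The weighted sum of 1/t converges:
    [weight_node_sum] with p = 1 gives the constant 18 = 2 * 3^2. *)
Lemma partial_theta_discretize (x : R) (s : C) (A K : nat) : 0 < x -> 0 < Re s ->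
  Cmod (partial_theta x s A K
        - csum (fun j => cpow_neg s (INR (S j))
                         * RtoC (box_count x A (S j) - box_count x A j))%C K)%C
  <= 18 * exp (- 1 / 2 * ln x) * Cmod s.
Proof.
intros Hx Hs.
set (d := fun (n m j : nat) =>
  ind_le (node x n m) (INR (S j)) - ind_le (node x n m) (INR j)).
replace (csum (fun j => cpow_neg s (INR (S j))
    * RtoC (box_count x A (S j) - box_count x A j))%C K)
  with (csum (fun n => csum (fun m => RtoC (weight n m)
    * csum (fun j => cpow_neg s (INR (S j)) * RtoC (d n m j)) K) A) A)%C.
- unfold partial_theta. rewrite <- csum_minus.
  eapply Rle_trans.
  + apply (csum_norm _ (fun n => rsum (fun m => 2 * Cmod s *
      (weight n m * exp (- 1 * ln (node x n m)))) A)); intros n _.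
    rewrite <- csum_minus. apply csum_norm; intros m _.
    rewrite RtoC_mult.
    replace (_ - _)%C with (RtoC (weight n m) * (RtoC (ind_le (node x n m) (INR K)) * cpow_neg s (node x n m)
      - csum (fun j => cpow_neg s (INR (S j)) * RtoC (d n m j)) K))%C by ring.
    rewrite Cmod_mult, Cmod_R, Rabs_pos_eq by apply weight_nonneg.
    replace (2 * Cmod s * (weight n m * exp (- 1 * ln (node x n m))))
      with (weight n m * (2 * Cmod s * exp (- 1 * ln (node x n m)))) by ring.
    apply Rmult_le_compat_l; [apply weight_nonneg|].
    apply ceiling_bound; [assumption|now apply node_ge_1].
  + rewrite (rsum_ext _ (fun n => 2 * Cmod s * rsum (fun m => weight n m * exp (- 1 * ln (node x n m))) A))
      by (intros; apply rsum_scal).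
    rewrite rsum_scal.
    pose proof (weight_node_sum x 1 A A Hx Rlt_0_1) as H.
    replace (18 * exp (- 1 / 2 * ln x) * Cmod s)
      with (2 * Cmod s * (exp (- 1 / 2 * ln x) * ((1 + 2 / 1) * (1 + 2 / 1)))) by field.
    pose proof (Cmod_ge_0 s). apply Rmult_le_compat_l; [lra|assumption].
(* Moving the sum over j outermost collects the pairs with ceiling j + 1, whose total weight is the
   increment of [box_count]. *)
- transitivity (csum (fun n => csum (fun j => csum (fun m =>
    cpow_neg s (INR (S j)) * RtoC (weight n m * d n m j)%R) A) K) A)%C.
  + apply csum_ext; intros n _. rewrite csum_swap. apply csum_ext; intros m _.
    rewrite <- csum_scal. apply csum_ext; intros j _. rewrite RtoC_mult. ring.
  + rewrite csum_swap. apply csum_ext; intros j _.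
    rewrite (csum_ext _ (fun n => cpow_neg s (INR (S j)) * RtoC (rsum (fun m => weight n m * d n m j)%R A))%C).
    2: { intros n _. rewrite <- csum_RtoC. apply csum_scal. }
    rewrite csum_scal, csum_RtoC. do 2 f_equal.
    unfold box_count.
    replace (rsum _ A - rsum _ A) with
      (rsum (fun n => rsum (fun m => weight n m * ind_le (node x n m) (INR (S j))) A) A
       + -1 * rsum (fun n => rsum (fun m => weight n m * ind_le (node x n m) (INR j)) A) A) by ring.
    rewrite <- rsum_scal, <- rsum_plus. apply rsum_ext; intros n _.
    rewrite <- rsum_scal, <- rsum_plus. apply rsum_ext; intros m _. unfold d. ring.
Qed.

Lemma box_count_0 (x : R) (A : nat) : 0 < x -> box_count x A 0 = 0.
Proof.
intros Hx. unfold box_count.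
apply rsum_0; intros n _.
apply rsum_0; intros m _.
rewrite ind_le_0; [ring|]. pose proof (node_ge_1 x n m Hx). simpl; lra.
Qed.

(** * Summation by parts and comparison with the main term *)

(** From 1 + L <= 2 exp(L/2): the logarithm is traded for half a power, and the result stays
    summable. *)
Lemma one_plus_ln_over_square (n : nat) :
  (1 + ln (INR (S n))) / INR (S n) ^ 2 <= 2 * zterm (1 / 2) n.
Proof.
unfold zterm. pose proof (INR_S_pos n) as Hn. set (L := ln (INR (S n))).
replace (INR (S n)) with (exp L) by (now apply exp_ln).
replace (- (1 + 1 / 2) * L) with (L / 2 + - L + - L) by field.
rewrite !exp_plus, exp_Ropp. pose proof (exp_ineq1_le (L / 2)). pose proof (exp_pos L).
replace ((1 + L) / exp L ^ 2) with ((1 + L) * / exp L * / exp L) by (field; lra).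
assert (0 < / exp L) by now apply Rinv_0_lt_compat.
rewrite <- !Rmult_assoc. do 2 (apply Rmult_le_compat_r; [lra|]). lra.
Qed.

Lemma main_poly_bound (x L : R) : 0 <= L ->
  Rabs (main_poly x L)
  <= (1 + Rabs (2 * euler_gamma - ln x)
      + Rabs (euler_gamma ^ 2 - euler_gamma * ln x - PI ^ 2 / 6)) * (1 + L) ^ 2.
Proof.
intros HL. unfold main_poly.
set (b := 2 * euler_gamma - ln x). set (k := euler_gamma ^ 2 - _ - _).
eapply Rle_trans; [apply Rabs_triang|].
eapply Rle_trans; [apply Rplus_le_compat_r, Rabs_triang|].
rewrite Rabs_mult, (Rabs_pos_eq L), (Rabs_pos_eq (L ^ 2)) by nra.
pose proof (Rabs_pos b). pose proof (Rabs_pos k). nra.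
Qed.

(** The order of quantifiers matters: M is uniform in s, while D may depend on s because its term
    tends to 0 as K grows with s fixed. Neither depends on A. *)
Lemma partial_theta_estimate (x : R) : 0 < x -> exists M : R,
  forall s : C, 0 < Re s -> exists D : R, forall A K : nat,
  (S K <= A)%nat -> INR (S K) <= INR A * x ->
  Cmod (partial_theta x s A (S K) - main_primitive x s 0)%C
  <= M * Cmod s + D * ((1 + ln (INR (S (S K)))) ^ 2 * exp (- Re s * ln (INR (S (S K))))).
Proof.
intros Hx. destruct (box_count_asymptotics x Hx) as [c [Hc Hbox]].
set (beta := Rabs (2 * euler_gamma - ln x)).
assert (Hbeta : 0 <= beta) by apply Rabs_pos.
set (kappa := Rabs (euler_gamma ^ 2 - euler_gamma * ln x - PI ^ 2 / 6)).
assert (Hkappa : 0 <= kappa) by apply Rabs_pos.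
(* The first summand is the cost of rounding. In the second, 2c comes from replacing [box_count] by
   [main_poly], 2(2 + beta) from [main_step_bound], and 2 * 3 bounds the sum of (1 +
   L_j)/(j+1)^2. *)
exists (18 * exp (- 1 / 2 * ln x) + (2 * c + 2 * (2 + beta)) * (2 * 3)).
intros s Hs.
(* Bounds for the boundary term: the first summand is for [box_count], the others for the three
   terms of [main_primitive]. *)
exists ((1 + beta + kappa + c) + Cmod (/ s) * (2 + beta) + Cmod (2 / (s * s)) + (1 + beta + kappa)).
intros A K HA HAx.
set (L := fun j => ln (INR (S j))).
assert (HL : forall j, 0 <= L j) by (intros; apply ln_INR_nonneg).
assert (HLinc : forall j, 0 <= L (S j) - L j <= / INR (S j)).
{ intros j. pose proof (ln_INR_S_bounds (S j) ltac:(lia)).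
  pose proof (Rinv_0_lt_compat _ (INR_S_pos (S j))). unfold L; lra. }
assert (Hinv1 : forall j, / INR (S j) <= 1).
{ intros j. rewrite <- Rinv_1. apply Rinv_le_contravar; [lra|].
  rewrite S_INR. pose proof (pos_INR j); lra. }
assert (Hb : forall j, (j <= K)%nat -> Rabs (box_count x A (S j) - main_poly x (L j))
  <= c * ((1 + L j) / INR (S j))).
{ intros j Hj. apply Hbox; [lia|]. apply Rle_trans with (2 := HAx), le_INR; lia. }
pose proof (partial_theta_discretize x s A (S K) Hx Hs) as Hdisc.
rewrite csum_by_parts in Hdisc by now apply box_count_0.
(* F j - F (S j) is the integral of s exp(-s u) [main_poly x u] over [L j, L (S j)], so the
   integrals telescope. *)
set (F := fun j => (Cexp (- s * RtoC (L j)) * main_primitive x s (L j))%C).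
set (T := csum _ (S K)) in Hdisc.
assert (HT : Cmod (T - csum (fun j => (- F (S j)) - (- F j)) (S K))%C
  <= (2 * c + 2 * (2 + beta)) * (2 * 3) * Cmod s).
{ unfold T. rewrite <- csum_minus.
  apply Rle_trans with (rsum (fun j => (2 * c + 2 * (2 + beta)) * Cmod s * 2 * zterm (1 / 2) j) (S K)).
  - apply csum_norm; intros j Hj.
    assert (Hij : 0 < / INR (S j)) by apply Rinv_0_lt_compat, INR_S_pos.
    change (cpow_neg s (INR (S j))) with (Cexp (- s * RtoC (L j))).
    change (cpow_neg s (INR (S (S j)))) with (Cexp (- s * RtoC (L (S j)))).
    specialize (Hb j ltac:(lia)). specialize (HLinc j). specialize (Hinv1 j).
    pose proof (HL j) as HLj.
    pose proof (main_step_bound x s (L j) (L (S j)) Hs ltac:(lra) ltac:(lra)) as Hm.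
    fold beta in Hm.
    pose proof (Cexp_increment s (L j) (L (S j)) ltac:(lra) ltac:(lra)) as He.
    pose proof (one_plus_ln_over_square j) as Hz. fold (L j) in Hz.
    pose proof (Cmod_ge_0 s) as Hms.
    replace (_ - _)%C with
      (- (RtoC (box_count x A (S j) - main_poly x (L j)) * (Cexp (- s * RtoC (L (S j))) - Cexp (- s * RtoC (L j))))
       + (RtoC (main_poly x (L j)) * (Cexp (- s * RtoC (L j)) - Cexp (- s * RtoC (L (S j)))) - (F j - F (S j))))%C
      by (rewrite RtoC_minus; ring).
    eapply Rle_trans; [apply Cmod_triangle|].
    apply Rle_trans with ((2 * c + 2 * (2 + beta)) * Cmod s * ((1 + L j) / INR (S j) ^ 2)).
    + replace (_ * ((1 + L j) / INR (S j) ^ 2)) with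
        (c * ((1 + L j) / INR (S j)) * (2 * Cmod s * / INR (S j))
         + 2 * Cmod s * ((2 + beta) * (1 + L j)) * (/ INR (S j)) ^ 2)
        by (field; pose proof (INR_S_pos j); lra).
      apply Rplus_le_compat.
      * rewrite Cmod_opp, Cmod_mult, Cmod_R.
        apply Rmult_le_compat; [apply Rabs_pos|apply Cmod_ge_0|assumption|].
        eapply Rle_trans; [exact He|]. apply Rmult_le_compat_l; lra.
      * unfold F. eapply Rle_trans; [exact Hm|].
        apply Rmult_le_compat.
        -- apply Rmult_le_pos; lra.
        -- apply pow2_ge_0.
        -- apply Rmult_le_compat_l; [lra|]. nra.
        -- apply pow_incr; lra.
    + rewrite !Rmult_assoc. rewrite <- (Rmult_assoc _ (Cmod s)), <- (Rmult_assoc _ (Cmod s)).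
      apply Rmult_le_compat_l; [|lra]. apply Rmult_le_pos; lra.
  - rewrite rsum_scal.
    pose proof (zterm_sum_bound (1 / 2) (S K) ltac:(lra)) as Hz.
    replace ((2 * c + 2 * (2 + beta)) * (2 * 3) * Cmod s)
      with ((2 * c + 2 * (2 + beta)) * Cmod s * 2 * (1 + / (1 / 2))) by field.
    apply Rmult_le_compat_l; [|assumption].
    pose proof (Cmod_ge_0 s). repeat apply Rmult_le_pos; lra. }
rewrite (csum_telescope (fun j => (- F j)%C)) in HT.
assert (HF0 : F 0%nat = main_primitive x s 0).
{ unfold F, L. simpl INR. rewrite ln_1, Cmult_0_r.
  replace (Cexp 0) with (RtoC 1); [ring|].
  unfold Cexp, RtoC; simpl. rewrite exp_0, cos_0, sin_0. f_equal; ring. }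
rewrite HF0 in HT.
(* The boundary term of the summation by parts and the upper end of the telescoped integrals carry
   the same power (K+2)^-s, which makes both vanish as K grows. *)
set (Bd := (RtoC (box_count x A (S K)) * cpow_neg s (INR (S (S K))) - F (S K))%C).
assert (HBd : Cmod Bd <= ((1 + beta + kappa + c) + Cmod (/ s) * (2 + beta) + Cmod (2 / (s * s)) + (1 + beta + kappa))
  * ((1 + L (S K)) ^ 2 * exp (- Re s * L (S K)))).
{ replace Bd with (Cexp (- s * RtoC (L (S K))) * (RtoC (box_count x A (S K)) - main_primitive x s (L (S K))))%C
    by (unfold Bd, F, cpow_neg, L; ring).
  rewrite Cmod_mult, Cmod_Cexp_real, Rmult_comm, <- Rmult_assoc.
  apply Rmult_le_compat_r; [left; apply exp_pos|].
  pose proof (HL K) as HL0. specialize (HLinc K). specialize (Hb K ltac:(lia)).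
  pose proof (main_poly_bound x (L K) HL0) as H1. fold beta kappa in H1.
  assert (HLS : L K <= L (S K)) by lra.
  pose proof (main_poly_bound x (L (S K)) ltac:(lra)) as H2. fold beta kappa in H2.
  set (u := L (S K)) in *. set (B := box_count x A (S K)) in *.
  assert (Hu : 1 <= (1 + u) ^ 2) by nra.
  assert (Hu1 : 1 + u <= (1 + u) ^ 2) by nra.
  assert (HB : Rabs B <= (1 + beta + kappa + c) * (1 + u) ^ 2).
  { replace B with (main_poly x (L K) + (B - main_poly x (L K))) by ring.
    eapply Rle_trans; [apply Rabs_triang|].
    assert ((1 + beta + kappa) * (1 + L K) ^ 2 <= (1 + beta + kappa) * (1 + u) ^ 2)
      by (apply Rmult_le_compat_l; [lra|apply pow_incr; lra]).
    assert (c * ((1 + L K) / INR (S K)) <= c * (1 + u) ^ 2).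
    { apply Rmult_le_compat_l; [lra|]. specialize (Hinv1 K). unfold Rdiv. nra. }
    lra. }
  unfold main_primitive.
  replace (RtoC B - _)%C with (RtoC B + ((- (RtoC (main_poly x u)))
    + (- (/ s * RtoC (2 * u + (2 * euler_gamma - ln x))) + - (2 / (s * s)))))%C
    by (unfold Cdiv; ring).
  eapply Rle_trans; [apply Cmod_triangle|]. eapply Rle_trans;
    [apply Rplus_le_compat_l, Cmod_triangle|]. eapply Rle_trans;
    [apply Rplus_le_compat_l, Rplus_le_compat_l, Cmod_triangle|].
  rewrite !Cmod_opp, Cmod_mult, !Cmod_R.
  assert (H3 : Rabs (2 * u + (2 * euler_gamma - ln x)) <= (2 + beta) * (1 + u) ^ 2).
  { eapply Rle_trans; [apply Rabs_triang|]. fold beta. rewrite Rabs_pos_eq by lra. nra. }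
  pose proof (Cmod_ge_0 (/ s)). pose proof (Cmod_ge_0 (2 / (s * s))).
  assert (Cmod (/ s) * Rabs (2 * u + (2 * euler_gamma - ln x))
    <= Cmod (/ s) * ((2 + beta) * (1 + u) ^ 2)) by (apply Rmult_le_compat_l; assumption).
  assert (Cmod (2 / (s * s)) * 1 <= Cmod (2 / (s * s)) * (1 + u) ^ 2)
    by (apply Rmult_le_compat_l; assumption).
  lra. }
change (ln (INR (S (S K)))) with (L (S K)).
match goal with |- Cmod (?p - ?m)%C <= _ => replace (p - m)%C with
  ((p - (RtoC (box_count x A (S K)) * cpow_neg s (INR (S (S K))) + T)) + (T - (- F (S K) - - m)) + Bd)%C
  by (unfold Bd; ring) end.
eapply Rle_trans; [apply Cmod_triangle|]. apply Rplus_le_compat; [|exact HBd].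
eapply Rle_trans; [apply Cmod_triangle|]. rewrite Rmult_plus_distr_r.
apply Rplus_le_compat; assumption.
Qed.

(** * Iterated series as limits of square partial sums *)

Lemma Series_tail (a : nat -> R) (n : nat) : ex_series a ->
  Series a - rsum a n = Series (fun k => a (n + k)%nat).
Proof.
intros Ha. induction n as [|n IH]; [apply Rminus_0_r|].
cbn [rsum]. assert (Hn : ex_series (fun k => a (n + k)%nat)) by now apply (ex_series_incr_n a).
rewrite (Series_incr_1 (fun k => a (n + k)%nat)), Nat.add_0_r in IH by assumption.
transitivity (Series (fun k => a (n + S k)%nat)); [lra|].
apply Series_ext; intros k. f_equal; lia.
Qed.

Lemma Series_tail_bound (a b : nat -> R) (n : nat) :
  (forall k, Rabs (a k) <= b k) -> ex_series b ->
  Rabs (Series a - rsum a n) <= Series b - rsum b n.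
Proof.
intros Hab Hb.
assert (Haa : ex_series (fun k => Rabs (a k))).
{ apply (ex_series_le (K := R_AbsRing) (V := R_CompleteNormedModule) _ b); [|assumption].
  intros k. change (Rabs (Rabs (a k)) <= b k). rewrite Rabs_Rabsolu. apply Hab. }
rewrite !Series_tail; [|assumption|now apply ex_series_Rabs].
eapply Rle_trans; [apply Series_Rabs|apply Series_le].
- now apply (ex_series_incr_n (fun k => Rabs (a k))).
- intros k. split; [apply Rabs_pos|apply Hab].
- now apply (ex_series_incr_n b).
Qed.

Lemma Series_bound (a b : nat -> R) :
  (forall k, Rabs (a k) <= b k) -> ex_series b -> Rabs (Series a) <= Series b.
Proof.
intros Hab Hb. pose proof (Series_tail_bound a b 0 Hab Hb) as H. simpl in H.
now rewrite !Rminus_0_r in H.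
Qed.

(** The pairs outside the square are the rows from n on, which give the first summand, and the tails
    of the first n rows, which give the second. *)
Lemma double_Series_tail_bound (f : nat -> nat -> R) (g h : nat -> R) (n : nat) :
  (forall k, 0 <= g k) -> (forall k, 0 <= h k) ->
  (forall i j, Rabs (f i j) <= g i * h j) -> ex_series g -> ex_series h ->
  Rabs (Series (fun i => Series (f i)) - rsum (fun i => rsum (f i) n) n)
  <= Series h * (Series g - rsum g n) + Series g * (Series h - rsum h n).
Proof.
intros Hg0 Hh0 Hf Hg Hh.
assert (Hgh : forall i, ex_series (fun j => g i * h j)) by (intros; now apply @ex_series_scal).
replace (Series _ - _) with ((Series (fun i => Series (f i)) - rsum (fun i => Series (f i)) n)
  + rsum (fun i => Series (f i) + -1 * rsum (f i) n) n)
  by (rewrite rsum_plus, rsum_scal; ring).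
eapply Rle_trans; [apply Rabs_triang|]. apply Rplus_le_compat.
- rewrite Rmult_minus_distr_l, <- rsum_scal, <- Series_scal_l.
  apply Series_tail_bound.
  + intros i. rewrite Rmult_comm, <- Series_scal_l. now apply Series_bound.
  + now apply @ex_series_scal.
- apply Rle_trans with (rsum (fun i => (Series h - rsum h n) * g i) n).
  + apply rsum_abs; intros i _.
    replace (Series (f i) + -1 * rsum (f i) n) with (Series (f i) - rsum (f i) n) by ring.
    rewrite Rmult_comm, Rmult_minus_distr_l, <- rsum_scal, <- Series_scal_l.
    now apply Series_tail_bound.
  + rewrite rsum_scal, Rmult_comm.
    assert (H1 := Series_tail_bound g g n (fun k => Req_le _ _ (Rabs_pos_eq _ (Hg0 k))) Hg).
    assert (H2 := Series_tail_bound h h n (fun k => Req_le _ _ (Rabs_pos_eq _ (Hh0 k))) Hh).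
    pose proof (Rabs_pos (Series g - rsum g n)). pose proof (Rabs_pos (Series h - rsum h n)).
    apply Rmult_le_compat_r; lra.
Qed.

Lemma Re_csum (a : nat -> C) (n : nat) : Re (csum a n) = rsum (fun k => Re (a k)) n.
Proof. induction n; simpl; [|rewrite <- IHn]; reflexivity. Qed.

Lemma Im_csum (a : nat -> C) (n : nat) : Im (csum a n) = rsum (fun k => Im (a k)) n.
Proof. induction n; simpl; [|rewrite <- IHn]; reflexivity. Qed.

Lemma is_lim_seq_rsum (a : nat -> R) : ex_series a -> is_lim_seq (rsum a) (Series a).
Proof.
intros Ha. apply is_lim_seq_incr_1.
apply is_lim_seq_ext with (sum_n a); [apply rsum_sum_n|].
apply (Series_correct a Ha).
Qed.

Lemma double_CSeries_approx (f : nat -> nat -> C) (g h : nat -> R) :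
  (forall k, 0 <= g k) -> (forall k, 0 <= h k) ->
  (forall i j, Cmod (f i j) <= g i * h j) -> ex_series g -> ex_series h ->
  forall eps, 0 < eps -> eventually (fun n =>
    Cmod (CSeries (fun i => CSeries (f i)) - csum (fun i => csum (f i) n) n)%C <= eps).
Proof.
intros Hg0 Hh0 Hf Hg Hh eps Heps.
assert (Hlim : is_lim_seq (fun n => 2 * (Series h * (Series g - rsum g n)
  + Series g * (Series h - rsum h n))) 0).
{ replace (Finite 0) with (Finite (2 * (Series h * (Series g - Series g) + Series g * (Series h - Series h))))
    by (f_equal; ring).
  apply is_lim_seq_mult'; [apply is_lim_seq_const|].
  apply is_lim_seq_plus'; (apply is_lim_seq_mult'; [apply is_lim_seq_const|]);
    (apply is_lim_seq_minus'; [apply is_lim_seq_const|now apply is_lim_seq_rsum]). }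
apply is_lim_seq_spec in Hlim. specialize (Hlim (mkposreal eps Heps)).
revert Hlim; apply filter_imp; intros n Hn. simpl in Hn. rewrite Rminus_0_r in Hn.
apply Rle_trans with (2 := Rlt_le _ _ Hn). eapply Rle_trans; [|apply Rle_abs].
eapply Rle_trans; [apply Cmod_le_Re_Im|].
rewrite <- Rplus_diag. apply Rplus_le_compat.
- replace (Re _) with (Series (fun i => Series (fun j => Re (f i j)))
    - rsum (fun i => rsum (fun j => Re (f i j)) n) n).
  + apply double_Series_tail_bound; auto.
    intros i j. eapply Rle_trans; [apply Re_le_Cmod|apply Hf].
  + rewrite (rsum_ext _ (fun i => Re (csum (f i) n))) by (intros; now rewrite Re_csum).
    rewrite <- Re_csum. reflexivity.
- replace (Im _) with (Series (fun i => Series (fun j => Im (f i j)))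
    - rsum (fun i => rsum (fun j => Im (f i j)) n) n).
  + apply double_Series_tail_bound; auto.
    intros i j. eapply Rle_trans; [apply Im_le_Cmod|apply Hf].
  + rewrite (rsum_ext _ (fun i => Im (csum (f i) n))) by (intros; now rewrite Im_csum).
    rewrite <- Im_csum. reflexivity.
Qed.

Lemma ex_series_zterm (p : R) : 0 < p -> ex_series (zterm p).
Proof.
intros Hp. destruct (ex_finite_lim_seq_incr (sum_n (zterm p)) (1 + / p)) as [l Hl].
- intros n. rewrite sum_Sn. change (sum_n (zterm p) n <= sum_n (zterm p) n + zterm p (S n)).
  pose proof (zterm_pos p (S n)); lra.
- intros n. rewrite rsum_sum_n. now apply zterm_sum_bound.
- now exists l.
Qed.

(** * Vanishing of the remainders and conclusion *)

(** exp(pL/3) >= 1 + pL/3 >= k(1 + L) for k = min(1, p/3); cubing gives c = k^-3. *)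
Lemma exp_beats_square (p : R) : 0 < p -> exists c, 0 < c /\
  forall L, 0 <= L -> (1 + L) ^ 2 * exp (- p * L) <= c / (1 + L).
Proof.
intros Hp. set (k := Rmin 1 (p / 3)).
assert (Hk : 0 < k) by (apply Rmin_glb_lt; lra).
assert (Hk1 : k <= 1) by apply Rmin_l. assert (Hk2 : k <= p / 3) by apply Rmin_r.
assert (Hk3 : 0 < k ^ 3) by now apply pow_lt.
exists (/ k ^ 3). split; [now apply Rinv_0_lt_compat|]. intros L HL.
assert (He : (k * (1 + L)) ^ 3 <= exp (p * L)).
{ replace (p * L) with (p / 3 * L + p / 3 * L + p / 3 * L) by field. rewrite !exp_plus.
  replace (exp _ * _ * _) with (exp (p / 3 * L) ^ 3) by ring.
  apply pow_incr. pose proof (exp_ineq1_le (p / 3 * L)). nra. }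
rewrite Rpow_mult_distr in He.
replace (- p * L) with (- (p * L)) by ring. rewrite exp_Ropp.
pose proof (exp_pos (p * L)) as Hpos.
apply Rmult_le_reg_r with (k ^ 3 * (1 + L) * exp (p * L)).
- repeat apply Rmult_lt_0_compat; lra.
- replace (_ * / exp (p * L) * _) with (k ^ 3 * (1 + L) ^ 3) by (field; lra).
  replace (/ k ^ 3 / (1 + L) * _) with (exp (p * L)) by (field; lra).
  assumption.
Qed.

Lemma remainder_small (p D1 D2 eps : R) : 0 < p -> 0 < eps -> exists K : nat,
  D1 * exp (- (p / 2) * ln (INR (S K)))
  + D2 * ((1 + ln (INR (S (S K)))) ^ 2 * exp (- p * ln (INR (S (S K))))) <= eps.
Proof.
intros Hp Heps.
destruct (exp_beats_square (p / 2)) as [c1 [Hc1 H1]]; [lra|].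
destruct (exp_beats_square p Hp) as [c2 [Hc2 H2]].
set (E := Rabs D1 * c1 + Rabs D2 * c2).
(* Both terms together are at most E/(1 + L) with L = ln (K+1), and this K gives L >= E/eps. *)
destruct (INR_unbounded (exp (E / eps))) as [K HK]. exists K.
pose proof (ln_INR_nonneg K) as HL. specialize (H1 _ HL).
pose proof (ln_INR_S_bounds (S K) ltac:(lia)) as Hinc.
pose proof (Rinv_0_lt_compat _ (INR_S_pos (S K))).
set (L := ln (INR (S K))) in *. set (L' := ln (INR (S (S K)))) in *.
specialize (H2 L' ltac:(lra)).
assert (HLE : E / eps <= L).
{ unfold L. rewrite <- (ln_exp (E / eps)). apply ln_le; [apply exp_pos|].
  rewrite S_INR; lra. }
assert (Hdiv : c2 / (1 + L') <= c2 / (1 + L)).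
{ apply Rmult_le_compat_l; [lra|]. apply Rinv_le_contravar; lra. }
pose proof (Rle_abs D1). pose proof (Rle_abs D2).
pose proof (Rabs_pos D1). pose proof (Rabs_pos D2).
pose proof (exp_pos (- (p / 2) * L)). pose proof (exp_pos (- p * L')).
assert (Ha : D1 * exp (- (p / 2) * L) <= Rabs D1 * (c1 / (1 + L))).
{ apply Rle_trans with (Rabs D1 * exp (- (p / 2) * L)); [apply Rmult_le_compat_r; lra|].
  apply Rmult_le_compat_l; [lra|].
  apply Rle_trans with (2 := H1). nra. }
assert (Hb : D2 * ((1 + L') ^ 2 * exp (- p * L')) <= Rabs D2 * (c2 / (1 + L))).
{ apply Rle_trans with (Rabs D2 * ((1 + L') ^ 2 * exp (- p * L'))).
  - apply Rmult_le_compat_r; [|lra]. apply Rmult_le_pos; [apply pow2_ge_0|lra].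
  - apply Rmult_le_compat_l; lra. }
apply Rle_trans with (E / (1 + L)); [unfold E, Rdiv in *; lra|].
apply Rmult_le_reg_r with (1 + L); [lra|].
replace (E / (1 + L) * (1 + L)) with (E / eps * eps) by (field; lra).
nra.
Qed.

Lemma Theta_summand (x : R) (s : C) (n m : nat) : 0 < x ->
  (/ (RtoC (INR (S n)) * RtoC (INR (S m)) * Rcpow (INR (S n) + INR (S m) * x) s))%C
  = (RtoC (weight n m) * cpow_neg s (node x n m))%C.
Proof.
intros Hx. unfold weight, cpow_neg, node, Rcpow.
pose proof (INR_S_pos n). pose proof (INR_S_pos m).
replace (- s * RtoC (ln (INR (S n) + INR (S m) * x)))%C
  with (- (s * RtoC (ln (INR (S n) + INR (S m) * x))))%C by ring.
rewrite Cexp_neg, RtoC_inv, RtoC_mult by nra. field.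
split; [apply Cexp_neq_0|]. split; intros E; apply RtoC_inj in E; lra.
Qed.

(** The terms left have t = n + m x > K + 1. Half of the exponent Re s is spent on the decay in K,
    the other half keeps the double sum bounded uniformly in A. *)
Lemma partial_theta_tail (x : R) (s : C) (A K : nat) : 0 < x -> 0 < Re s ->
  Cmod (csum (fun n => csum (fun m =>
          RtoC (weight n m) * cpow_neg s (node x n m)) A) A - partial_theta x s A (S K))%C
  <= exp (- (Re s / 2) / 2 * ln x) * ((1 + 2 / (Re s / 2)) * (1 + 2 / (Re s / 2)))
     * exp (- (Re s / 2) * ln (INR (S K))).
Proof.
intros Hx Hs. unfold partial_theta. rewrite <- csum_minus.
rewrite Rmult_comm. set (e := exp (- (Re s / 2) * ln (INR (S K)))).
assert (He : 0 < e) by apply exp_pos.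
eapply Rle_trans;
  [|apply Rmult_le_compat_l; [lra|apply (weight_node_sum x (Re s / 2) A A Hx); lra]].
rewrite <- rsum_scal. apply csum_norm; intros n _.
rewrite <- csum_minus, <- rsum_scal. apply csum_norm; intros m _.
replace (_ - _)%C with (RtoC (weight n m * (1 - ind_le (node x n m) (INR (S K)))) * cpow_neg s (node x n m))%C
  by (rewrite !RtoC_mult, RtoC_minus; ring).
unfold cpow_neg. rewrite Cmod_mult, Cmod_R, Cmod_Cexp_real.
pose proof (weight_nonneg n m) as Hw. pose proof (exp_pos (- (Re s / 2) * ln (node x n m))) as Hp.
destruct (Rle_dec (node x n m) (INR (S K))) as [H|H].
- rewrite ind_le_1, Rminus_diag, Rmult_0_r, Rabs_R0, Rmult_0_l by assumption.
  repeat apply Rmult_le_pos; lra.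
- apply Rnot_le_lt in H. rewrite ind_le_0, Rminus_0_r, Rmult_1_r, Rabs_pos_eq by assumption.
  rewrite <- Rmult_assoc, (Rmult_comm e), Rmult_assoc. apply Rmult_le_compat_l; [assumption|].
  replace (- Re s * ln (node x n m))
    with (- (Re s / 2) * ln (node x n m) + - (Re s / 2) * ln (node x n m)) by field.
  rewrite exp_plus. apply Rmult_le_compat_r; [lra|]. apply exp_le.
  assert (ln (INR (S K)) <= ln (node x n m)) by (apply ln_le; [apply INR_S_pos|lra]). nra.
Qed.

Theorem theorem1p1 :
  forall x : R, 0 < x ->
  exists M delta : R, 0 < delta /\
    forall z : C, 1 < Re z -> Cmod (z - 1)%C < delta ->
      Cmod (Theta z x
            - (2 / ((z - 1) * (z - 1))
               + RtoC (2 * euler_gamma - ln x) / (z - 1)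
               + RtoC (euler_gamma ^ 2 - euler_gamma * ln x - PI ^ 2 / 6)))%C
      <= M * Cmod (z - 1)%C.
Proof.
intros x Hx. destruct (partial_theta_estimate x Hx) as [M HM].
(* The estimate holds on the whole half-plane Re z > 1, hence the arbitrary radius 1. *)
exists M, 1. split; [lra|]. intros z Hz _.
set (s := (z - 1)%C).
assert (Hs : 0 < Re s) by (unfold s; destruct z; simpl in *; lra).
replace (_ + RtoC (euler_gamma ^ 2 - euler_gamma * ln x - PI ^ 2 / 6))%C with (main_primitive x s 0).
2: { unfold main_primitive, main_poly.
     replace (0 ^ 2 + _ * 0 + _) with (euler_gamma ^ 2 - euler_gamma * ln x - PI ^ 2 / 6) by ring.
     replace (2 * 0 + _) with (2 * euler_gamma - ln x) by ring.
     ring. }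
destruct (HM s Hs) as [D HD].
set (f := fun n m => (RtoC (weight n m) * cpow_neg s (node x n m))%C).
assert (HTheta : Theta z x = CSeries (fun n => CSeries (f n))).
{ assert (E : forall n m, f n m = (/ (RtoC (INR (S n)) * RtoC (INR (S m))
    * Rcpow (INR (S n) + INR (S m) * x) (z - 1)))%C) by (intros; symmetry; now apply Theta_summand).
  unfold Theta, CSeries. f_equal; apply Series_ext; intros n; apply Series_ext; intros m;
    now rewrite E. }
(* With z fixed, K is chosen first, to make the tail and the boundary term together at most eps/2;
   then A, depending on K, brings the box sum within eps/2 of [Theta z x]. *)
apply le_epsilon; intros eps Heps.
set (D1 := exp (- (Re s / 2) / 2 * ln x) * ((1 + 2 / (Re s / 2)) * (1 + 2 / (Re s / 2)))).
destruct (remainder_small (Re s) D1 D (eps / 2) Hs ltac:(lra)) as [K HK].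
destruct (double_CSeries_approx f (fun n => exp (- Re s / 2 * ln x) * zterm (Re s / 2) n) (zterm (Re s / 2)))
  with (eps := eps / 2) as [A0 HA0].
- intros k. apply Rmult_le_pos; left; [apply exp_pos|apply zterm_pos].
- intros k. left; apply zterm_pos.
- intros i j. unfold f, cpow_neg.
  rewrite Cmod_mult, Cmod_R, Rabs_pos_eq, Cmod_Cexp_real, Rmult_assoc by apply weight_nonneg.
  apply weight_node_bound; lra.
- apply @ex_series_scal, ex_series_zterm. lra.
- apply ex_series_zterm. lra.
- lra.
- destruct (INR_unbounded (INR (S K) / x)) as [A1 HA1].
  (* A0 serves the approximation of the series, A1 the condition K + 1 <= A x, and S K the condition
     K + 1 <= A. *)
  set (A := (A0 + A1 + S K)%nat).
  assert (HA : INR (S K) <= INR A * x).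
  { assert (INR A1 <= INR A) by (apply le_INR; unfold A; lia).
    replace (INR (S K)) with (INR (S K) / x * x) by (field; lra).
    apply Rmult_le_compat_r; lra. }
  specialize (HA0 A ltac:(unfold A; lia)). rewrite <- HTheta in HA0.
  specialize (HD A K ltac:(unfold A; lia) HA).
  pose proof (partial_theta_tail x s A K Hx Hs) as Ht. fold D1 in Ht.
  set (box := csum (fun n => csum (f n) A) A) in *.
  change (csum _ A) with box in Ht.
  replace (Theta z x - main_primitive x s 0)%C with
    ((Theta z x - box) + ((box - partial_theta x s A (S K))
     + (partial_theta x s A (S K) - main_primitive x s 0)))%C by ring.
  eapply Rle_trans; [apply Cmod_triangle|].
  eapply Rle_trans; [apply Rplus_le_compat_l, Cmod_triangle|]. lra.
Qed.
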